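(* Let $n$ be a positive integer and $\mathbf b=(b_1,\dots,b_n)\in\mathbb Z_{>0}^n$, not with $n=1=b_1$. If $b_1>1$, the combinatorial diameter of $\mathfrak X_n(\mathbf b)$ is exactly $\min\{2n,\ \tfrac12n(n-1)+1\}$. If $b_1=1$, the combinatorial diameter of $\mathfrak X_n(\mathbf b)$ is exactly $\min\{2(n-1),\ \tfrac12n(n-1)\}$.
   Context: A $\mathbf b$-parking function is a list $(\beta_1,\dots,\beta_n)$ of positive integers whose nondecreasing rearrangement $\beta'_1\le\cdots\le\beta'_n$ satisfies $\beta'_i\le b_1+\cdots+b_i$ for all $i$. The $\mathbf b$-parking-function polytope $\mathfrak X_n(\mathbf b)\subset\mathbb R^n$ is the convex hull of all $\mathbf b$-parking functions. The combinatorial diameter of a polytope is the diameter of its edge graph (vertices and edges of the polytope), i.e. the maximum over pairs of vertices of the length of a shortest edge-path between them. *)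

(* Defs.v *)
From mathcomp Require Import all_boot all_order all_algebra.
From mathcomp Require Import boolp classical_sets reals convex.

Set Implicit Arguments.
Unset Strict Implicit.
Unset Printing Implicit Defensive.

Import Order.TTheory GRing.Theory Num.Theory.

Local Open Scope classical_set_scope.
Local Open Scope ring_scope.

Section Polytopes.
Variables (R : realType) (n : nat).
Implicit Types (P F E : set 'rV[R]_n) (u v : 'rV[R]_n).

Definition convex_hull (A : set 'rV[R]_n) : set 'rV[R]_n :=
  smallest (@convex_set R 'rV[R]_n) A.

(* F = P `&` {x | c . x = c0} for some inequality c . x <= c0 valid on P; *)
(* the choices c = 0, c0 = 0 and c = 0, c0 = 1 give the faces P and set0. *)
Definition is_face P F : Prop :=
  exists (c : 'cV[R]_n) (c0 : R),
    (forall x, P x -> (x *m c) 0 0 <= c0) /\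
    F = [set x | P x /\ (x *m c) 0 0 = c0].

(* The affine hull of F has dimension d: for some base point p of F and some *)
(* d points p + row i B of F, the rows of B form a basis of the direction    *)
(* space of the affine hull. No d satisfies this when F is empty.            *)
Definition has_affine_dim F (d : nat) : Prop :=
  exists (p : 'rV[R]_n) (B : 'M[R]_(d, n)),
    [/\ F p, forall i, F (p + row i B), row_free B &
        forall x, F x -> (x - p <= B)%MS].

Definition is_vertex P v : Prop :=
  is_face P [set v] /\ has_affine_dim [set v] 0.

Definition is_edge P E : Prop := is_face P E /\ has_affine_dim E 1.

Definition adjacent P u v : Prop :=
  [/\ is_vertex P u, is_vertex P v, u <> v & exists E, [/\ is_edge P E, E u & E v]].

(* u :: s is a walk from u to v in the edge graph of P; its length is size s *)
Definition edge_path P u v (s : seq 'rV[R]_n) : Prop :=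
  path (fun x y => `[< adjacent P x y >]) u s /\ last u s = v.

Definition is_edge_distance P u v (k : nat) : Prop :=
  (exists s, edge_path P u v s /\ size s = k) /\
  (forall s, edge_path P u v s -> (k <= size s)%N).

Definition is_combinatorial_diameter P (d : nat) : Prop :=
  (forall u v, is_vertex P u -> is_vertex P v ->
     exists k, is_edge_distance P u v k /\ (k <= d)%N) /\
  (exists u v, [/\ is_vertex P u, is_vertex P v & is_edge_distance P u v d]).

End Polytopes.

(* Indices start at 0: b i stands for b_(i+1), so the bound on the i-th entry *)
(* of the nondecreasing rearrangement is the sum of the b j with j <= i.      *)
Definition is_parking_function (n : nat) (b : 'I_n -> nat) (beta : n.-tuple nat)
    : Prop :=
  (forall i : 'I_n, (0 < tnth beta i)%N) /\
  (forall i : 'I_n, (nth 0 (sort leq beta) i <= \sum_(j < n | j <= i) b j)%N).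

Definition parking_polytope (R : realType) (n : nat) (b : 'I_n -> nat)
    : set 'rV[R]_n :=
  convex_hull [set x | exists beta : n.-tuple nat,
    is_parking_function b beta /\ x = \row_(i < n) (tnth beta i)%:R].

Arguments parking_polytope R {n} b.

(* Main.v *)
Require Import Defs.
From mathcomp Require Import all_boot all_order all_algebra fingroup perm.
From mathcomp Require Import boolp classical_sets reals convex interval_inference.
From mathcomp Require Import zify ring lra.

(* Put B_h = b_1 + ... + b_h. The vertices of the polytope are the points     *)
(* with entries B_n, B_(n-1), ..., B_(n-k+1) in some ordered choice of k      *)
(* coordinates and 1 elsewhere, i.e. partial rankings of the coordinates. The *)
(* polytope is simple, and its edges exchange two consecutive ranked          *)
(* coordinates or rank / unrank the last one (for b_1 = 1 the rankings of     *)
(* length n - 1 and n coincide, so that the last two coordinates of a full    *)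
(* ranking may be exchanged as well). A point is shown to be a vertex with    *)
(* the expected edges by exhibiting dual bases of edge vectors and facet      *)
(* normals; that there are no other vertices follows by maximising a linear   *)
(* functional over the known ones.                                            *)
(* Upper bound: unrank everything and rank again, or bubble sort.             *)
(* Lower bound: along a walk let M be the set of coordinates which stay       *)
(* ranked. Every other coordinate costs its unranking and its ranking, and a  *)
(* pair meeting M must be exchanged whenever its order changes. Between a     *)
(* ranking and its reversal every pair counts, and the resulting function of  *)
(* |M| is concave, hence minimal at an extreme value of |M|.                  *)

Set Implicit Arguments.
Unset Strict Implicit.
Unset Printing Implicit Defensive.

Import Order.TTheory GRing.Theory Num.Theory.

(** * Simple vertices of a convex set *)

Section SimpleVertices.
Local Open Scope classical_set_scope.
Local Open Scope ring_scope.
Variables (R : realType) (n : nat).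
Implicit Types (P F E : set 'rV[R]_n) (u v x y : 'rV[R]_n) (c : 'cV[R]_n).

(** A partial ranking is encoded by heights: the coordinate of rank r has height n - r, an unranked
    one height 0, and a vertex replaces each height h by B_h, with B_0 read as 1. At such a point
    the sums over the top-ranked coordinates are maximal and the unranked coordinates minimal; these
    n tight inequalities have a dual basis of edge vectors, each leading to another point of the
    family. This determines all vertices ([vertex_point]) and all edges ([point_adjacent],
    [point_adjacent_inv]), so the theorem becomes a question about swapping, deleting, appending and
    replacing entries of rankings.

    Upper bound: rankings of lengths k and l are joined through the empty ranking in k + l steps, or
    by completing both and sorting in C(n,2) swaps.

    Lower bound: [cost_bound_move] shows that each move lowers a suitable cost by at most one.
    Between a ranking and its reversal, with c coordinates not kept and u unranked coordinates at
    the two ends together, a walk of length m satisfies 2m >= n(n-1) + 5c - c^2 - 2u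
    ([cost_bound_reversed]). The right side is concave in c; small c yields the quadratic term of
    the minimum and c = n the linear one. *)

Lemma functionalD x y c : ((x + y) *m c) 0 0 = (x *m c) 0 0 + (y *m c) 0 0.
Proof. by rewrite mulmxDl [LHS]mxE. Qed.

Lemma functionalB x y c : ((x - y) *m c) 0 0 = (x *m c) 0 0 - (y *m c) 0 0.
Proof. by rewrite functionalD mulNmx [X in _ + X]mxE. Qed.

Lemma functionalZ (a : R) x c : ((a *: x) *m c) 0 0 = a * (x *m c) 0 0.
Proof. by rewrite -scalemxAl [LHS]mxE. Qed.

Lemma convex_hull_halfspace (A : set 'rV[R]_n) c (a : R) x :
  (forall y, A y -> (y *m c) 0 0 <= a) ->
  convex_hull A x -> (x *m c) 0 0 <= a.
Proof.
move=> hA; apply: (@smallest_sub _ _ A [set y | (y *m c) 0 0 <= a]) => //.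
move=> y z t; rewrite !inE /= => hy hz.
rewrite functionalD !functionalZ.
have t0 : 0 <= t%:num by [].
have t1 : t%:num <= 1 by [].
rewrite /unstable.onem; nra.
Qed.

(* The rows of [D] span the edges at [x] and the columns of [C] are inner     *)
(* normals of the facets at [x]; each edge vector is dual to one facet.       *)
Definition simple_at P x (D C : 'M[R]_n) (e : 'I_n -> R) : Prop :=
  [/\ P x, D *m C = 1%:M, forall i, 0 < e i, forall i, P (x + e i *: row i D) &
      forall y i, P y -> 0 <= ((y - x) *m C) 0 i].

Lemma has_affine_dim_set1 v : has_affine_dim [set v] 0.
Proof.
exists v, 0; split => //; first by case.
- by rewrite /row_free mxrank0.
- by move=> y ->; rewrite subrr sub0mx.
Qed.

Lemma edge_collinear P E u v w : is_edge P E -> E u -> E v -> E w -> u <> v ->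
  exists t, w - u = t *: (v - u).
Proof.
move=> [_ [p [B [_ _ _ hB]]]] /hB/sub_rVP[a ha] /hB/sub_rVP[b hb].
move=> /hB/sub_rVP[c hc] uv.
have ab : b - a != 0.
  apply/eqP => /subr0_eq ba; apply: uv; apply: (addIr (- p)).
  by rewrite ha hb ba.
have vu : v - u = (b - a) *: B by rewrite scalerBl -ha -hb opprB addrA subrK.
exists ((c - a) / (b - a)).
by rewrite vu scalerA divfK // scalerBl -ha -hc opprB addrA subrK.
Qed.

Lemma vertex_not_between P a b v (t : R) : is_vertex P v -> P a -> P b ->
  v <> a -> v <> b -> 0 <= t <= 1 -> v <> a + t *: (b - a).
Proof.
move=> [[c [c0 [hc hv]]] _] Pa Pb va vb t01 vE.
have [_ vc] : [set y | P y /\ (y *m c) 0 0 = c0] v by rewrite -hv.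
have lt w : P w -> v <> w -> (w *m c) 0 0 < c0.
  move=> Pw vw; rewrite lt_neqAle hc // andbT; apply/eqP => wc.
  by apply: vw; have : [set v] w by rewrite hv.
have la := lt _ Pa va; have lb := lt _ Pb vb.
move: vc; rewrite vE functionalD functionalZ functionalB => vc.
by case/andP: t01 => t0 t1; clear -la lb vc t0 t1; have [|] := ltP 0 t; nra.
Qed.

Section AtVertex.
Variables (P : set 'rV[R]_n) (x : 'rV[R]_n) (D C : 'M[R]_n) (e : 'I_n -> R).
Hypothesis sx : simple_at P x D C e.

Let DC : D *m C = 1%:M. Proof. by case: sx. Qed.

(** The entries of [(y - x) *m C] are the coordinates of [y - x] in the edge basis, nonnegative on
    [P], and [D *m c] lists the slopes of [c] along the edges. Hence signs of slopes alone decide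
    optimality at [x]. *)
Lemma simple_at_expand y c :
  (y *m c) 0 0 = (x *m c) 0 0 + \sum_i ((y - x) *m C) 0 i * (D *m c) i 0.
Proof.
have -> : \sum_i ((y - x) *m C) 0 i * (D *m c) i 0 = ((y - x) *m c) 0 0.
  rewrite -[in RHS](mul1mx c) -(mulmx1C DC) -mulmxA mulmxA [RHS]mxE.
  by apply: eq_bigr => i _.
by rewrite functionalB addrC subrK.
Qed.

Lemma edge_end_mul i c :
  ((x + e i *: row i D) *m c) 0 0 = (x *m c) 0 0 + e i * (D *m c) i 0.
Proof. by rewrite functionalD functionalZ -row_mul [X in _ + _ * X]mxE. Qed.

Lemma simple_at_local_max c :
  (forall i, ((x + e i *: row i D) *m c) 0 0 <= (x *m c) 0 0) ->
  forall y, P y -> (y *m c) 0 0 <= (x *m c) 0 0.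
Proof.
case: sx => _ _ e0 _ hC hc y Py; rewrite (simple_at_expand y) gerDl.
apply: sumr_le0 => i _; apply: mulr_ge0_le0; first exact: hC.
by have := hc i; rewrite edge_end_mul gerDl pmulr_rle0.
Qed.

(* The supporting functional has slope [- d i] along the [i]-th edge.         *)
Lemma simple_at_face (d : 'cV[R]_n) : (forall i, 0 <= d i 0) ->
  is_face P [set y | P y /\ forall i, d i 0 != 0 -> ((y - x) *m C) 0 i = 0].
Proof.
case: sx => Px _ e0 _ hC d0.
have DCd i : (D *m - (C *m d)) i 0 = - d i 0.
  by rewrite mulmxN mulmxA DC mul1mx mxE.
exists (- (C *m d)), ((x *m - (C *m d)) 0 0); split.
  move=> y Py; rewrite (simple_at_expand y) gerDl.
  apply: sumr_le0 => i _; rewrite DCd mulrN oppr_le0.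
  by rewrite mulr_ge0 ?hC.
apply/seteqP; split => y /= [Py hy]; split => //.
  rewrite (simple_at_expand y) big1 ?addr0 // => i _; rewrite DCd.
  have [->|/hy ->] := eqVneq (d i 0) 0; first by rewrite oppr0 mulr0.
  by rewrite mul0r.
move: hy; rewrite (simple_at_expand y) => /eqP; rewrite -subr_eq0 addrAC subrr.
rewrite add0r -oppr_eq0 -sumrN psumr_eq0; last first.
  by move=> i _; rewrite DCd mulrN opprK mulr_ge0 ?hC.
move=> /allP h i di; have := h i (mem_index_enum _).
by rewrite DCd mulrN opprK mulf_eq0 (negPf di) orbF => /eqP.
Qed.

Lemma simple_at_decomp y : y = x + ((y - x) *m C) *m D.
Proof. by rewrite -mulmxA (mulmx1C DC) mulmx1 addrC subrK. Qed.

Lemma simple_at_vertex : is_vertex P x.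
Proof.
split; last exact: has_affine_dim_set1.
have := @simple_at_face (const_mx 1); set F := [set y | _].
suff -> : F = [set x] by apply => i; rewrite mxE.
apply/seteqP; split => y /=.
  move=> [_ hy]; rewrite (simple_at_decomp y).
  suff -> : (y - x) *m C = 0 by rewrite mul0mx addr0.
  by apply/rowP => i; rewrite hy ?mxE // oner_eq0.
move=> ->; split; first by case: sx.
by move=> i _; rewrite subrr mul0mx mxE.
Qed.

Lemma edge_vector_neq0 i : e i *: row i D != 0.
Proof.
have [_ _ /(_ i) e0 _ _] := sx.
rewrite scaler_eq0 negb_or (gt_eqF e0) /=; apply/eqP => Di.
have := congr1 (row i) DC; rewrite row_mul Di mul0mx => /rowP/(_ i).
by rewrite !mxE eqxx => /eqP; rewrite eq_sym oner_eq0.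
Qed.

Lemma simple_at_adjacent i : is_vertex P (x + e i *: row i D) ->
  adjacent P x (x + e i *: row i D).
Proof.
move=> vi; have [Px _ e0 Pe _] := sx.
split => //; first exact: simple_at_vertex.
  move=> /(congr1 (fun z => z - x)); rewrite subrr addrAC subrr add0r => h.
  by have := edge_vector_neq0 i; rewrite -h eqxx.
pose d : 'cV[R]_n := \col_j (j != i)%:R.
have dE j : (d j 0 != 0) = (j != i).
  by rewrite mxE; case: (j != i); rewrite ?eqxx ?oner_eq0.
have hF : forall j, 0 <= d j 0 by move=> j; rewrite mxE ler0n.
exists [set y | P y /\ forall j, d j 0 != 0 -> ((y - x) *m C) 0 j = 0].
have Ex : P x /\ forall j, d j 0 != 0 -> ((x - x) *m C) 0 j = 0.
  by split => // j _; rewrite subrr mul0mx mxE.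
have Ei : P (x + e i *: row i D) /\ forall j, d j 0 != 0 ->
    ((x + e i *: row i D - x) *m C) 0 j = 0.
  split => // j; rewrite dE => ji.
  rewrite addrAC subrr add0r -scalemxAl -row_mul DC !mxE eq_sym (negPf ji).
  by rewrite mulr0.
split => //; split; first exact: simple_at_face.
exists x, (e i *: row i D); split => //.
- by move=> j; rewrite row_id.
- by rewrite /row_free rank_rV edge_vector_neq0.
- move=> y [_ hy]; rewrite {1}(simple_at_decomp y) addrAC subrr add0r.
  apply/sub_rVP; exists (((y - x) *m C) 0 i / e i).
  rewrite scalerA divfK ?gt_eqF // mulmx_sum_row (bigD1 i) //= big1 ?addr0 //.
  by move=> j ji; rewrite hy ?scale0r // dE.
Qed.

(** The functional exposing the edge has no positive slope at [x], so its slope vanishes in every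
    direction [i] that [v - x] uses. The end point in such a direction then lies on the same edge,
    hence on the ray from [x] through [v]; two vertices on one ray coincide, since otherwise one
    would lie between [x] and the other. *)
Lemma simple_at_adjacent_inv v :
  (forall i, is_vertex P (x + e i *: row i D)) ->
  adjacent P x v -> exists i, v = x + e i *: row i D.
Proof.
move=> hv [vx vv xv [E [Edge Ex Ev]]].
have [Px _ e0 Pe hC] := sx.
have [[c [c0 [hc EE]]] _] := Edge.
have [_ xc] : [set y | P y /\ (y *m c) 0 0 = c0] x by rewrite -EE.
have [Pv vc] : [set y | P y /\ (y *m c) 0 0 = c0] v by rewrite -EE.
have Dc i : (D *m c) i 0 <= 0.
  by have := hc _ (Pe i); rewrite edge_end_mul xc gerDl pmulr_rle0.
have s0 i : ((v - x) *m C) 0 i * (D *m c) i 0 = 0.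
  have := simple_at_expand v c; rewrite vc xc => /eqP.
  rewrite eq_sym -subr_eq0 addrAC subrr add0r -oppr_eq0 -sumrN psumr_eq0.
    by move=> /allP /(_ i (mem_index_enum _)) /=; rewrite oppr_eq0 => /eqP.
  by move=> j _; rewrite oppr_ge0 mulr_ge0_le0 ?hC.
have [i li] : exists i, ((v - x) *m C) 0 i != 0.
  apply/existsP; rewrite -[X in is_true X]negbK; apply/negP => /existsPn h.
  apply: xv; rewrite (simple_at_decomp v).
  suff -> : (v - x) *m C = 0 by rewrite mul0mx addr0.
  by apply/rowP => i; rewrite [RHS]mxE; apply/eqP/negPn/h.
exists i.
have Ei : E (x + e i *: row i D).
  rewrite EE /=; split => //; rewrite edge_end_mul xc.
  have /eqP := s0 i; rewrite mulf_eq0 (negPf li) /= => /eqP ->.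
  by rewrite mulr0 addr0.
have [t] := edge_collinear Edge Ex Ev Ei xv.
rewrite addrAC subrr add0r => ht.
have lt0 : 0 < ((v - x) *m C) 0 i by rewrite lt_neqAle eq_sym li hC.
have eit : e i = t * ((v - x) *m C) 0 i.
  have /rowP/(_ i) := congr1 (mulmx^~ C) ht.
  by rewrite -!scalemxAl -row_mul DC !mxE eqxx mulr1.
have t0 : 0 < t by rewrite -(pmulr_lgt0 _ lt0) -eit.
apply: contrapT => vne; have [t1|t1] := leP t 1.
  apply: (@vertex_not_between P x v (x + e i *: row i D) t) => //.
  - by move=> h; move/eqP: (edge_vector_neq0 i); apply; apply: (addrI x); rewrite h addr0.
  - by move=> h; apply: vne.
  - by rewrite (ltW t0).
  - by rewrite ht.
apply: (@vertex_not_between P x (x + e i *: row i D) v t^-1) => //.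
- by move=> h; apply: xv.
- by rewrite invr_ge0 (ltW t0) invf_le1 // (ltW t1).
- by rewrite addrAC subrr add0r ht scalerA mulVf ?gt_eqF // scale1r addrC subrK.
Qed.

End AtVertex.

(** The best member of the family for the functional exposing [v] beats its neighbours, which belong
    to the family too. A local maximum at a simple point is global, so this member lies in the face
    [[set v]]. *)
Lemma vertex_in_simple_family (T : finType) (t0 : T) P (pt : T -> 'rV[R]_n) v :
  (forall t, exists D C e, simple_at P (pt t) D C e /\
     forall i, exists t', pt t + e i *: row i D = pt t') ->
  is_vertex P v -> exists t, v = pt t.
Proof.
move=> hT [[c [c0 [hc hv]]] _].
pose F t := (pt t *m c) 0 0.
have [t _ ht] := @Order.TotalTheory.arg_maxP _ _ _ t0 predT F isT.
exists t; have [D [C [e [sx nb]]]] := hT t.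
have [Pv vc] : [set y | P y /\ (y *m c) 0 0 = c0] v by rewrite -hv.
have [Px _ _ _ _] := sx.
suff : [set v] (pt t) by [].
rewrite hv; split => //; apply/eqP; rewrite eq_le hc //= -vc.
apply: (simple_at_local_max sx) => // i.
by have [t' ->] := nb i; exact: ht.
Qed.

End SimpleVertices.

(** * A lower bound for the length of walks *)

Section Cost.
Local Open Scope nat_scope.
Variables (T : finType) (t : T -> nat).
Implicit Types (M : {set T}) (h g : T -> nat) (a b i j : T).

(** Removing an entry from [M] can move the charge of a pair from (i, j) to (j, i), so weights are
    only comparable after symmetrisation. *)
Lemma leq_sum_sym (w1 w2 : T -> T -> nat) :
  (forall i j, w1 i j + w1 j i <= w2 i j + w2 j i) ->
  \sum_i \sum_j w1 i j <= \sum_i \sum_j w2 i j.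
Proof.
move=> w12.
have sym w : \sum_i \sum_j (w i j + w j i) = 2 * \sum_i \sum_j w i j :> nat.
  under eq_bigr do rewrite big_split /=.
  by rewrite big_split /= [X in _ + X]exchange_big /= mul2n addnn.
rewrite -(@leq_pmul2l 2) // -!sym.
by apply: leq_sum => i _; apply: leq_sum => j _; exact: w12.
Qed.

Lemma sum_eq1 a : \sum_i (i == a : nat) = 1.
Proof.
rewrite (bigD1 a) //= eqxx big1 // => i /negPf ->; by [].
Qed.

Lemma sum_eq2 a b : \sum_i \sum_j ((i == a) && (j == b) : nat) = 1.
Proof.
rewrite (bigD1 a) //= [X in _ + X]big1 ?addn0; last first.
  by move=> i /negPf ->; rewrite big1.
by rewrite eqxx /= sum_eq1.
Qed.

Definition supp_cost M h i : nat :=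
  if i \in M then 0 else (0 < h i) + (0 < t i).

(** Two kept entries need an exchange if their order differs in [h] and [t]. An entry [i] outside
    [M] must sink below each kept [j] under it before being unranked, and must climb above each kept
    [j] under it in the target. *)
Definition pair_cost M h i j : nat :=
  if j \in M then
    if i \in M then ((h j < h i) && (t i < t j) : nat) else (h j < h i) + (t j < t i)
  else 0.

(* A lower bound for the number of edges of a walk from [h] to [t] during     *)
(* which exactly the entries in [M] never leave the support.                  *)
Definition cost M h : nat :=
  \sum_i supp_cost M h i + \sum_i \sum_j pair_cost M h i j.

Lemma cost_swap M h g a b :
  (forall i, i \notin M -> 0 < h i -> 0 < g i) ->
  (forall i j, h j < h i -> g j < g i \/ i = a /\ j = b) ->
  cost M h <= (cost M g).+1.
Proof.
move=> hs hw; rewrite /cost -addnS; apply: leq_add.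
  apply: leq_sum => i _; rewrite /supp_cost; case: ifPn => // iM.
  by have := hs i iM; lia.
rewrite -addn1 -(sum_eq2 a b) -big_split /=; apply: leq_sum => i _.
rewrite -big_split /=; apply: leq_sum => j _; rewrite /pair_cost.
have : (h j < h i) <= (g j < g i) + ((i == a) && (j == b)).
  have := hw i j; case: (h j < h i) => // /(_ isT) [->|[-> ->]] //.
  by rewrite !eqxx; lia.
by case: (j \in M); case: (i \in M); lia.
Qed.

(** The deleted entry is outside [M] and was ranked last, so no kept entry lay below it: only one
    unit of [supp_cost] is lost. *)
Lemma cost_delete M h g a :
  (forall i, i \in M -> 0 < g i) -> g a = 0 ->
  (forall i, i != a -> g i = h i /\ (h i = 0 \/ h a < h i)) ->
  cost M h <= (cost M g).+1.
Proof.
move=> Mg ga hg; rewrite /cost -addSn; apply: leq_add.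
  rewrite -addn1 -(sum_eq1 a) -big_split /=; apply: leq_sum => i _.
  rewrite /supp_cost; case: ifPn => // iM.
  by have := hg i; case: eqVneq => [->|ia] /=; [|case=> //]; lia.
apply: leq_sum => i _; apply: leq_sum => j _; rewrite /pair_cost.
have := hg i; have := hg j; have := Mg i; have := Mg j.
case: (eqVneq i a) => [->|ia]; case: (eqVneq j a) => [->|ja];
 case: (_ \in M) => //; case: (_ \in M) => //; lia.
Qed.

(** If [a] was kept, it now pays for its ranking. Its exchanges with kept entries are still charged:
    [a] is last in [g], so every such entry above it that [t] puts below it counts before and
    after. *)
Lemma cost_append M h g a :
  (forall i, i \in M -> 0 < g i) -> h a = 0 -> 0 < g a ->
  (forall i, i != a -> g i = h i /\ (h i = 0 \/ g a < h i)) ->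
  cost (M :\ a) h <= (cost M g).+1.
Proof.
move=> Mg ha ga hg; rewrite /cost -addSn; apply: leq_add.
  rewrite -addn1 -(sum_eq1 a) -big_split /=; apply: leq_sum => i _.
  rewrite /supp_cost !inE.
  have := hg i; case: (eqVneq i a) => [->|ia] /=; case: (_ \in M); lia.
apply: leq_sum_sym => i j; rewrite /pair_cost !inE.
have := hg i; have := hg j; have := Mg i; have := Mg j.
case: (eqVneq i a) => [->|ia]; case: (eqVneq j a) => [->|ja] /=;
 case: (_ \in M) => //=; case: (_ \in M) => //=; lia.
Qed.

(** The support unit of [a] in [h] is balanced by that of [b] in [g]. *)
Lemma cost_replace_notin M h g a b : b \notin M ->
  (forall i, i \in M -> 0 < g i) -> h b = 0 -> g a = 0 -> g b = h a ->
  0 < h a -> (forall i, i != a -> i != b -> g i = h i /\ h a < h i) ->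
  cost M h <= cost M g.
Proof.
move=> bM Mg hb ga gb ha hg.
have aM : a \notin M by apply/negP => /Mg; rewrite ga.
have ab : a != b by apply: contraTneq ha => ab; rewrite -gb -ab ga.
rewrite /cost; apply: leq_add.
  rewrite -(leq_add2r 1) -{1}(sum_eq1 b) -(sum_eq1 a) -!big_split /=.
  apply: leq_sum => i _; rewrite /supp_cost.
  have [->|ia] := eqVneq i a; first by rewrite (negPf aM) (negPf ab); lia.
  have [->|ib] := eqVneq i b; first by rewrite (negPf bM); lia.
  by have [-> _] := hg i ia ib; lia.
apply: leq_sum => i _; apply: leq_sum => j _; rewrite /pair_cost.
have [jM|//] := boolP (j \in M).
have ja : j != a by apply: contraNneq aM => <-.
have jb : j != b by apply: contraNneq bM => <-.
have := hg j ja jb.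
have [->|ia] := eqVneq i a; first by rewrite (negPf aM); lia.
have [->|ib] := eqVneq i b; first by rewrite (negPf bM); lia.
by have := hg i ia ib; case: (i \in M); lia.
Qed.

(** Dropping [b] from [M] may raise the support cost by two, for unranking [a] and ranking [b]. The
    ranked entry [c] outside [M] lies above the last entry [b] in [g]; the charge of this pair
    disappears and refunds one unit. *)
Lemma cost_replace_in M h g a b c : b \in M ->
  (forall i, i \in M -> 0 < g i) -> h b = 0 -> g a = 0 -> g b = h a ->
  0 < h a -> (forall i, i != a -> i != b -> g i = h i /\ h a < h i) ->
  c \notin M -> 0 < g c ->
  cost (M :\ b) h <= (cost M g).+1.
Proof.
move=> bM Mg hb ga gb ha hg cM gc.
have aM : a \notin M by apply/negP => /Mg; rewrite ga.
have ab : a != b by apply: contraTneq ha => ab; rewrite -gb -ab ga.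
have ca : c != a by apply: contraTneq gc => ->; rewrite ga.
have cb : c != b by apply: contraNneq cM => ->.
have supp : \sum_i supp_cost (M :\ b) h i <= \sum_i supp_cost M g i + 2.
  rewrite -[2]/(1 + 1) -{1}(sum_eq1 a) -(sum_eq1 b) -!big_split /=.
  apply: leq_sum => i _; rewrite /supp_cost !inE.
  have [->|ia] := eqVneq i a; first by rewrite (negPf aM) (negPf ab) /=; lia.
  have [->|ib] := eqVneq i b; first by rewrite bM /=; lia.
  by have [-> _] := hg i ia ib; rewrite /=; lia.
suff : \sum_i \sum_j pair_cost (M :\ b) h i j + 1
    <= \sum_i \sum_j pair_cost M g i j by rewrite /cost; lia.
rewrite -(sum_eq2 c b) -big_split /=.
under eq_bigr do rewrite -big_split /=.
apply: leq_sum_sym => i j; rewrite /pair_cost !inE.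
have [gcE hc] := hg c ca cb.
have {}hg k : k != a -> k != b -> g k = h k /\ h a < h k by exact: hg.
have [->|ic] := eqVneq i c; rewrite ?(negPf cM) ?(negPf cb) ?andbF /=.
  have [->|jc] := eqVneq j c; first by rewrite (negPf cM) andbF (negPf cb).
  have [->|jb] := eqVneq j b; first by rewrite bM /=; clear -gcE hc gb; lia.
  have [->|ja] := eqVneq j a; first by rewrite (negPf aM).
  have [-> _] := hg j ja jb; rewrite gcE.
  by case: (j \in M) => /=; clear; lia.
have [->|jc] := eqVneq j c; rewrite ?(negPf cM) ?(negPf cb) ?andbF /=.
  have [->|ib] := eqVneq i b; first by rewrite bM /=; clear -gcE hc gb; lia.
  have [->|ia] := eqVneq i a; first by rewrite (negPf aM).
  have [-> _] := hg i ia ib; rewrite gcE.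
  by case: (i \in M) => /=; clear; lia.
have [->|ib] := eqVneq i b; have [->|jb] := eqVneq j b; rewrite ?bM /=.
- by [].
- have [->|ja] := eqVneq j a; first by rewrite (negPf aM).
  have [-> hj] := hg j ja jb; rewrite gb hb.
  by case: (j \in M) => /=; clear -hj; lia.
- have [->|ia] := eqVneq i a; first by rewrite (negPf aM).
  have [-> hi] := hg i ia ib; rewrite gb hb.
  by case: (i \in M) => /=; clear -hi; lia.
have [->|ia] := eqVneq i a; have [->|ja] := eqVneq j a; rewrite ?(negPf aM) //=.
- have [-> hj] := hg j ja jb; rewrite ga.
  by case: (j \in M) => //=; clear -hj; lia.
- have [-> hi] := hg i ia ib; rewrite ga.
  by case: (i \in M) => //=; clear -hi; lia.
have [-> _] := hg i ia ib; have [-> _] := hg j ja jb.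
by case: (i \in M); case: (j \in M) => //=; clear; lia.
Qed.

(** Here no refunding entry exists, so every entry is switched to kept. Supports then cost nothing,
    and since [a] is last in the target, the only new inversion is that of [a] with [b]. *)
Lemma cost_setT_replace M h g a b : h b = 0 -> g a = 0 -> g b = h a ->
  0 < h a -> (forall i, i != a -> i != b -> g i = h i /\ h a < h i) ->
  a \notin M -> (forall i, i != a -> i \in M) -> t a = 0 ->
  cost [set: T]%SET h <= (cost M g).+1.
Proof.
move=> hb ga gb ha hg aM Ma ta.
have ab : a != b by apply: contraTneq ha => ab; rewrite -gb -ab ga.
have bM : b \in M by rewrite Ma // eq_sym.
rewrite /cost -addnS; apply: leq_add.
  by apply: leq_sum => i _; rewrite /supp_cost inE.
rewrite -addn1 -(sum_eq2 a b) -big_split /=.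
under [X in _ <= X]eq_bigr do rewrite -big_split /=.
apply: leq_sum => i _; apply: leq_sum => j _.
rewrite /pair_cost !inE.
have [->|ia] := eqVneq i a; have [->|ja] := eqVneq j a;
  rewrite ?ltnn ?(negPf aM) //=.
- rewrite Ma //; have [->|jb] := eqVneq j b => /=; first by rewrite addn1; case: (_ && _).
  by have [_ hj] := hg j ja jb; rewrite ltnNge (ltnW hj).
- by rewrite ta ltn0 andbF.
rewrite !Ma // addn0.
have [->|ib] := eqVneq i b; first by rewrite hb ltn0.
have [gi hi] := hg i ia ib.
have [->|jb] := eqVneq j b; first by rewrite gb gi hi; case: (_ < _); case: (_ < _).
by have [gj hj] := hg j ja jb; rewrite gi gj.
Qed.

(* [g] is a full permutation whose last two entries are unranked in [h]; the  *)
(* last entry [t0] of the target is one of them, or it is not.                *)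
Lemma cost_setT_append2 h g u t0 : u != t0 -> h u = 0 -> h t0 = 0 ->
  t t0 = 0 ->
  (forall i, i != u -> i != t0 -> [/\ g i = h i, g u < g i & g t0 < g i]) ->
  cost [set i | (i != u) && (i != t0)] h <= (cost [set: T]%SET g).+1.
Proof.
move=> ut hu ht0 tt0 hg.
rewrite /cost -addSn; apply: leq_add.
  rewrite -addn1 -(sum_eq1 u) -big_split /=.
  apply: leq_sum => i _; rewrite /supp_cost !inE.
  have [->|iu] /= := eqVneq i u; first by rewrite hu; case: (0 < t u).
  have [->|it] //= := eqVneq i t0; by rewrite ht0 tt0.
apply: leq_sum_sym => i j; rewrite /pair_cost !inE.
have key k l : k \in [:: u; t0] -> l != u -> l != t0 ->
   (h l < h k) + (t l < t k) <= (g k < g l) && (t l < t k).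
  move=> ku lu lt; have [_ gu gt] := hg l lu lt.
  by move: ku; rewrite !inE => /orP[]/eqP ->; rewrite ?hu ?ht0 ?gu ?gt.
have [->|iu] := eqVneq i u; have [->|ju] := eqVneq j u => //=.
- have [//|jt] := eqVneq j t0; have := key u j; rewrite !inE eqxx ju jt /=; lia.
- have [//|it] := eqVneq i t0; have := key u i; rewrite !inE eqxx iu it /=; lia.
have [->|it] := eqVneq i t0; have [->|jt] := eqVneq j t0 => //=.
- by have := key t0 j; rewrite !inE eqxx orbT ju jt /=; lia.
- by have := key t0 i; rewrite !inE eqxx orbT iu it /=; lia.
by have [-> _ _] := hg i iu it; have [-> _ _] := hg j ju jt.
Qed.

Lemma cost_setT_append3 h g a y t0 : a != y -> a != t0 -> y != t0 ->
  h a = 0 -> h y = 0 -> g y = 0 -> t t0 = 0 ->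
  (forall i, i != t0 -> 0 < t i) ->
  (forall i, i != a -> i != y -> g i = h i /\ g a < g i) ->
  cost [set i | [&& i != a, i != y & i != t0]] h <= (cost [set: T]%SET g).+1.
Proof.
move=> ay at0 yt ha hy gy tt0 tp hg.
have supp : \sum_i supp_cost [set i | [&& i != a, i != y & i != t0]] h i <= 1 + (1 + 1).
  rewrite -{1}(sum_eq1 a) -{1}(sum_eq1 y) -(sum_eq1 t0) -!big_split /=.
  apply: leq_sum => i _; rewrite /supp_cost !inE.
  have [->|ia] /= := eqVneq i a; first by rewrite ha; case: (0 < t a).
  have [->|iy] /= := eqVneq i y; first by rewrite hy; case: (0 < t y).
  by have [->|it] //= := eqVneq i t0; rewrite tt0; case: (0 < h t0).
(* The support cost may rise by three. Two units are refunded by the inversions of [t0] with [a] and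
   with [y], charged for [g] but no longer for [h]. *)
suff : \sum_i \sum_j pair_cost [set i | [&& i != a, i != y & i != t0]] h i j
    + (1 + 1) <= \sum_i \sum_j pair_cost [set: T]%SET g i j by rewrite /cost; lia.
rewrite -{1}(sum_eq2 t0 a) -(sum_eq2 t0 y) -!big_split /=.
under eq_bigr do rewrite -!big_split /=.
apply: leq_sum_sym => i j; rewrite /pair_cost !inE.
have lowa k : k != a -> k != y -> g a < g k by move=> ka ky; case: (hg k).
have lowy k : k != a -> k != y -> g y < g k.
  by move=> ka ky; have := lowa k ka ky; rewrite gy; lia.
have t0a : t0 != a by rewrite eq_sym.
have t0y : t0 != y by rewrite eq_sym.
have ta : 0 < t a by exact: tp.
have ty : 0 < t y by exact: tp.
have [->|ia] := eqVneq i a.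
  rewrite (negPf at0) /=; have [->|ja] := eqVneq j a; first by rewrite (negPf at0).
  have [->|jy] := eqVneq j y; first by rewrite (negPf yt).
  have [->|jt] := eqVneq j t0; first by rewrite (negPf ay) tt0 ta lowa // ltn0 !andbF.
  by rewrite ha ltn0 lowa //=; clear; lia.
have [->|iy] := eqVneq i y.
  rewrite (negPf yt) /=; have [->|ja] := eqVneq j a; first by rewrite (negPf at0).
  have [->|jy] := eqVneq j y; first by rewrite (negPf yt).
  have [->|jt] := eqVneq j t0; first by rewrite tt0 ty lowy // ltn0 !andbF.
  by rewrite hy ltn0 lowy //=; clear; lia.
have [gi hi] := hg i ia iy.
have [->|it] := eqVneq i t0 => /=.
  have [->|ja] := eqVneq j a; first by rewrite (negPf ay) tt0 ta lowa // ltn0 !andbF.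
  have [->|jy] := eqVneq j y; first by rewrite tt0 ty lowy // ltn0 !andbF.
  have [->|jt] //= := eqVneq j t0.
  have [gj hj] := hg j ja jy; have gt0 : g t0 = h t0 by case: (hg t0).
  by rewrite tt0 ltn0 tp // gj gt0 andbT; clear; lia.
have [->|ja] := eqVneq j a => /=.
  by rewrite ha ltn0 lowa //=; clear; lia.
have [->|jy] := eqVneq j y => /=.
  by rewrite hy ltn0 lowy //=; clear; lia.
have [gj hj] := hg j ja jy.
have [->|jt] := eqVneq j t0 => /=.
  have gt0 : g t0 = h t0 by case: (hg t0).
  by rewrite tt0 ltn0 tp // gi gt0 andbT; clear; lia.
by rewrite gi gj /=; clear; lia.
Qed.

(* [Replace] exchanges the last ranked entry of a full permutation with the   *)
(* invisible one.                                                             *)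
Inductive move (z : bool) h g : Prop :=
| Swap a b of 0 < h b & h b < h a & g a = h b & g b = h a &
    (forall i, i != a -> i != b -> g i = h i /\ (h i < h b \/ h a < h i))
| Delete a of 0 < h a & g a = 0 &
    (forall i, i != a -> g i = h i /\ (h i = 0 \/ h a < h i))
| Append a of h a = 0 & 0 < g a &
    (forall i, i != a -> g i = h i /\ (h i = 0 \/ g a < h i))
| Replace a b of z & h b = 0 & g a = 0 & g b = h a & 0 < h a &
    (forall i, i != a -> i != b -> g i = h i /\ h a < h i).

Lemma swap_gt h g a b : h b < h a -> g a = h b -> g b = h a ->
  (forall i, i != a -> i != b -> g i = h i /\ (h i < h b \/ h a < h i)) ->
  forall i j, h j < h i -> g j < g i \/ i = a /\ j = b.
Proof.
move=> hba ga gb hg i j.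
have [->|ia] := eqVneq i a; have [->|ja] := eqVneq j a; rewrite ?ltnn //.
- have [->|jb] := eqVneq j b; first by right.
  have [-> hj] := hg j ja jb; rewrite ga; clear -hj hba; lia.
- have [->|ib] := eqVneq i b; first by rewrite gb ga; clear -hba; lia.
  have [-> hi] := hg i ia ib; rewrite ga; clear -hi hba; lia.
have [->|ib] := eqVneq i b; have [->|jb] := eqVneq j b; rewrite ?ltnn //.
- have [-> hj] := hg j ja jb; rewrite gb; clear -hj hba; lia.
- have [-> hi] := hg i ia ib; rewrite gb; clear -hi hba; lia.
by have [-> _] := hg i ia ib; have [-> _] := hg j ja jb; left.
Qed.

Definition one_zero h : Prop := exists2 y, h y = 0 & forall i, i != y -> 0 < h i.

(* In the second alternative the walk only passes through full permutations,  *)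
(* whose last entry is invisible in the support.                              *)
Definition cost_bound (z : bool) h l : Prop := exists2 M, cost M h <= l &
  (forall i, i \in M -> 0 < h i /\ 0 < t i) \/
  [/\ z, M = [set: T]%SET & one_zero h].

(** Induction step for a walk read from its end: prepending a move may force a new choice of [M].
    Swaps and deletions preserve it, an append removes the appended entry, and a replacement may
    remove [b] or pass to the full set; an append leaves the full set again. *)
Lemma cost_bound_move (z : bool) h g l : (z -> exists y, h y = 0) -> (z -> one_zero t) ->
  move z h g -> cost_bound z g l -> cost_bound z h l.+1.
Proof.
move=> hz tz mv [M cM [kept|[zT MT [y gy gp]]]].
- have Mg i : i \in M -> 0 < g i by case/kept.
  have Mt i : i \in M -> 0 < t i by case/kept.
  case: mv => [a b hb hba ga gb hg|a ha ga hg|a ha ga hg|a b zT hb ga gb ha hg].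
  + exists M; last first.
      left => i iM; split; last exact: Mt.
      have [->|ia] := eqVneq i a; first exact: ltn_trans hb hba.
      by have [->//|ib] := eqVneq i b; have [<- _] := hg i ia ib; exact: Mg.
    apply: leq_trans (_ : (cost M g).+1 <= _) => //.
    apply: (@cost_swap _ _ _ a b).
      move=> i _ hi; have [->|ia] := eqVneq i a; first by rewrite ga.
      have [->|ib] := eqVneq i b; first by rewrite gb; exact: ltn_trans hb hba.
      by have [-> _] := hg i ia ib.
    exact: (swap_gt hba ga gb hg).
  + exists M; last first.
      left => i iM; split; last exact: Mt.
      have [->//|ia] := eqVneq i a; have [<- _] := hg i ia; exact: Mg.
    by apply: leq_trans (cost_delete Mg ga hg) _.
  + exists (M :\ a); first by apply: leq_trans (cost_append Mg ha ga hg) _.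
    left => i; rewrite !inE => /andP[ia iM]; split; last exact: Mt.
    by have [<- _] := hg i ia; exact: Mg.
  + have aM : a \notin M by apply/negP => /Mg; rewrite ga.
    have keep i : i \in M -> i != b -> 0 < h i.
      move=> iM ib; have ia : i != a by apply: contraNneq aM => <-.
      by have [<- _] := hg i ia ib; exact: Mg.
    have [bM|bM] := boolP (b \in M); last first.
      exists M; first by rewrite leqW // (leq_trans (cost_replace_notin bM Mg hb ga gb ha hg)).
      left => i iM; split; last exact: Mt.
      by apply: keep => //; apply: contraNneq bM => <-.
    (* Either a ranked entry outside [M] provides the refund, or [M] consists of all entries but
       [a]. *)
    have [c /andP[cnM gc]|full] := pickP [pred c | (c \notin M) && (0 < g c)].
      exists (M :\ b).
        exact: leq_trans (cost_replace_in bM Mg hb ga gb ha hg cnM gc) _.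
      left => i; rewrite !inE => /andP[ib iM]; split; [exact: keep|exact: Mt].
    have Ma i : i != a -> i \in M.
      move=> ia; have := full i; rewrite /= => /negbT; rewrite negb_and negbK.
      case/orP=> //; have [-> |ib] := eqVneq i b; first by rewrite gb ha.
      by have [-> hi] := hg i ia ib; rewrite (leq_ltn_trans _ hi).
    exists [set: T]%SET.
      apply: leq_trans (cost_setT_replace hb ga gb ha hg aM Ma _) _ => //.
      have [t0 tt0 _] := tz zT; have [<-//|ta] := eqVneq t0 a.
      by have := Mt t0 (Ma _ ta); rewrite tt0.
    right; split => //; exists b => // i ib.
    have [->//|ia] := eqVneq i a; have [_ hi] := hg i ia ib.
    exact: leq_ltn_trans hi.
subst M; case: mv => [a b hb hba ga gb hg|a ha ga hg|a ha ga hg|a b _ hb ga gb ha hg].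
- exists [set: T]%SET; last first.
    right; split => //; exists y.
      have ya : y != a by apply: contraTneq hb => ya; rewrite -ga -ya gy.
      have yb : y != b by apply: contraTneq hba => yb; rewrite -gb -yb gy.
      by have [<- _] := hg y ya yb.
    move=> i iy; have [->|ia] := eqVneq i a; first exact: ltn_trans hb hba.
    by have [->//|ib] := eqVneq i b; have [<- _] := hg i ia ib; exact: gp.
  apply: leq_trans (_ : (cost [set: T]%SET g).+1 <= _) => //.
  apply: (@cost_swap _ _ _ a b); first by move=> i; rewrite inE.
  exact: (swap_gt hba ga gb hg).
(* A deletion is impossible: [h] already has an unranked entry, so [g] would have two. *)
- have [x hx] := hz zT; have xa : x != a by apply: contraTneq ha => <-; rewrite hx.
  have ya : y != a -> False.
    by move=> ya; have := gp a; rewrite eq_sym ya ga => /(_ isT).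
  by have [gx _] := hg x xa; move: (gp x); case: eqVneq => [xy|_]; [case: ya; rewrite -xy|rewrite gx hx => /(_ isT)].
- have ay : a != y by apply: contraTneq ga => ->; rewrite gy.
  have hy : h y = 0 by rewrite -gy; case: (hg y); rewrite // eq_sym.
  have {}hg i : i != a -> i != y -> g i = h i /\ g a < g i.
    move=> ia iy; have [gi [hi|hi]] := hg i ia; rewrite gi; split => //.
    by have := gp i iy; rewrite gi hi.
  have hgp i : i != a -> i != y -> 0 < h i.
    by move=> ia iy; have [<- _] := hg i ia iy; exact: gp.
  have [t0 tt0 tp] := tz zT.
  have [at0|at0] := eqVneq a t0.
    exists [set i | (i != y) && (i != t0)]; last first.
      left => i; rewrite inE -at0 => /andP[iy ia]; split; first exact: hgp.
      by apply: tp; rewrite -at0.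
    apply: leq_trans (_ : (cost [set: T]%SET g).+1 <= _) => //; subst a.
    apply: cost_setT_append2; rewrite 1?eq_sym //.
    by move=> i iy it; have [-> gi] := hg i it iy; have hi := hgp i it iy; rewrite gy; split.
  have [yt|yt] := eqVneq y t0.
    exists [set i | (i != a) && (i != t0)]; last first.
      left => i; rewrite inE -yt => /andP[ia iy]; split; first exact: hgp.
      by apply: tp; rewrite -yt.
    apply: leq_trans (_ : (cost [set: T]%SET g).+1 <= _) => //; subst y.
    apply: cost_setT_append2 => //.
    by move=> i ia it; have [-> gi] := hg i ia it; have hi := hgp i ia it; rewrite gy; split.
  exists [set i | [&& i != a, i != y & i != t0]]; last first.
    left => i; rewrite inE => /and3P[ia iy it]; split; [exact: hgp|exact: tp].
  by apply: leq_trans (cost_setT_append3 ay at0 yt ha hy gy tt0 tp hg) _.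
- exists [set: T]%SET; last first.
    right; split => //; exists b => // i ib.
    have [->//|ia] := eqVneq i a; have [_ hi] := hg i ia ib.
    exact: leq_ltn_trans hi.
  have ga' : g a = h b by rewrite ga hb.
  apply: leq_trans (_ : (cost [set: T]%SET g).+1 <= _) => //.
  apply: (@cost_swap _ _ _ a b); first by move=> i; rewrite inE.
  apply: (swap_gt _ ga' gb) => //; first by rewrite hb.
  by move=> i ia ib; have [? ?] := hg i ia ib; split => //; right.
Qed.

End Cost.

(** * Partial rankings and the vertices they define *)

Section Points.
Local Open Scope ring_scope.
Variables (n : nat).
Implicit Types (p : {perm 'I_n}) (k : nat) (i j l r : 'I_n).

(* The coordinate [p r] has rank [r]; ranks from [k] on are forgotten.        *)
Definition height p k i : nat :=
  if (p^-1%g i < k)%N then (n - p^-1%g i)%N else 0%N.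

(* [t] marks the case b_1 = 1, k = n - 1, in which the vertex already is a    *)
(* full permutation.                                                          *)
Definition neighbor (t : bool) p k j : {perm 'I_n} * nat :=
  if (j < k)%N then
    if (j.+1 < k)%N then ((tperm j (insubd j j.+1) * p)%g, k) else (p, k.-1)
  else ((tperm (insubd j (k - t)%N) j * p)%g, (k + ~~ t)%N).

Lemma heightE p k r : height p k (p r) = if (r < k)%N then (n - r)%N else 0%N.
Proof. by rewrite /height permK. Qed.

Lemma height_tperm p k (a b r : 'I_n) :
  height (tperm a b * p)%g k (p r) =
  if (tperm a b r < k)%N then (n - tperm a b r)%N else 0%N.
Proof. by rewrite /height invMg tpermV permM permK. Qed.

Lemma val_insubd_ord j (m : nat) : (m < n)%N -> insubd j m = m :> nat.
Proof. by move=> mn; rewrite val_insubd mn. Qed.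

Lemma perm_forall p (Q : 'I_n -> Prop) : (forall r, Q (p r)) -> forall i, Q i.
Proof. by move=> h i; rewrite -(permKV p i). Qed.

Lemma neighbor_move (z : nat) p k j (t := (0 < z)%N && (k + z == n)%N) :
  (z <= 1)%N -> (z < n)%N -> (k + z <= n)%N ->
  move (0 < z)%N (height p k)
    (height (neighbor t p k j).1 (neighbor t p k j).2).
Proof.
move=> z1 zn kn; have jn := ltn_ord j; rewrite /neighbor.
have pneq (a b : 'I_n) : p a != p b -> a != b :> nat.
  by rewrite (inj_eq perm_inj).
have [jk|kj] := ltnP j k.
  have [jk1|kj1] /= := ltnP j.+1 k.
    set j' := insubd j j.+1.
    have vj' : j' = j.+1 :> nat by rewrite val_insubd_ord //; lia.
    apply: (@Swap _ _ _ _ (p j) (p j')); rewrite ?height_tperm ?heightE ?tpermL ?tpermR ?vj' ?jk ?jk1 //.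
    1,2: by lia.
    apply: (perm_forall (p := p)) => r /pneq rj /pneq rj'.
    rewrite height_tperm heightE tpermD; [|by rewrite eq_sym -val_eqE|by rewrite eq_sym -val_eqE].
    by split => //; case: ifP; lia.
  apply: (@Delete _ _ _ _ (p j)); rewrite ?heightE ?jk //.
  - by lia.
  - by rewrite ifF //; lia.
  apply: (perm_forall (p := p)) => r /pneq rj.
  rewrite !heightE; do 2 case: ifP; lia.
set a := insubd j _.
have [t1|t0] := boolP t; rewrite /= ?addn0 ?addn1.
  have va : a = k.-1 :> nat by rewrite /a val_insubd_ord t1; lia.
  apply: (@Replace _ _ _ _ (p a) (p j)).
  - by move: t1; rewrite /t => /andP[].
  - by rewrite heightE ifF //; lia.
  - by rewrite height_tperm tpermL ifF //; lia.
  - by rewrite height_tperm tpermR heightE.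
  - by rewrite heightE va ifT; move: t1; rewrite /t; lia.
  apply: (perm_forall (p := p)) => r /pneq ra /pneq rj.
  rewrite height_tperm !heightE tpermD; [|by rewrite eq_sym -val_eqE|by rewrite eq_sym -val_eqE].
  have rk : (r < k.-1)%N by move: t1 (ltn_ord r); rewrite /t; lia.
  by split => //; rewrite va !ifT; move: t1; rewrite /t; lia.
have va : a = k :> nat by rewrite /a val_insubd_ord (negPf t0); lia.
apply: (@Append _ _ _ _ (p j)).
- by rewrite heightE ifF //; lia.
- by rewrite height_tperm tpermR va ltnSn; lia.
apply: (perm_forall (p := p)) => r /pneq rj.
rewrite !height_tperm heightE tpermR va ltnSn.
have rn := ltn_ord r.
case: tpermP => [ra|rj'|/eqP ra _].
- have ra' : r = k :> nat by rewrite ra.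
  by rewrite !ifF; lia.
- by rewrite rj' eqxx in rj.
have {}ra : r != a :> nat by [].
by do 2 case: ifP; lia.
Qed.

End Points.

(** * Walks in the edge graph and the diameter *)

Section Walks.
Variables (R : realType) (n : nat) (P : set 'rV[R]_n).
Implicit Types (x y w : 'rV[R]_n).
Local Open Scope nat_scope.

Definition within x y m : Prop := exists2 s, edge_path P x y s & size s <= m.

Lemma within_refl x m : within x x m.
Proof. by exists [::]. Qed.

Lemma within1 x y : adjacent P x y -> within x y 1.
Proof. by move=> xy; exists [:: y] => //; split => //=; rewrite andbT; apply/asboolP. Qed.

Lemma within_trans y x w m1 m2 :
  within x y m1 -> within y w m2 -> within x w (m1 + m2).
Proof.
move=> [s1 [p1 l1] sz1] [s2 [p2 l2] sz2]; exists (s1 ++ s2).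
  by split; [rewrite cat_path p1 l1|rewrite last_cat l1].
by rewrite size_cat leq_add.
Qed.

Lemma within_le x y m1 m2 : m1 <= m2 -> within x y m1 -> within x y m2.
Proof. by move=> m12 [s ps ss]; exists s => //; exact: leq_trans m12. Qed.

Lemma diameter_intro d :
  (forall x y, is_vertex P x -> is_vertex P y -> within x y d) ->
  (exists x y, [/\ is_vertex P x, is_vertex P y &
     forall s, edge_path P x y s -> d <= size s]) ->
  is_combinatorial_diameter P d.
Proof.
move=> up [x [y [vx vy low]]]; split.
  move=> u v vu vv; have [s ps sd] := up u v vu vv.
  pose Q k := `[< exists s, edge_path P u v s /\ size s = k >].
  have exQ : exists k, Q k by exists (size s); apply/asboolP; exists s.
  case: (ex_minnP exQ) => k /asboolP kQ kmin; exists k; split.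
    by split => // s' ps'; apply: kmin; apply/asboolP; exists s'.
  by apply: leq_trans sd; apply: kmin; apply/asboolP; exists s.
exists x, y; split => //; split => //.
have [s ps sd] := up x y vx vy; exists s; split => //.
by apply/eqP; rewrite eqn_leq sd low.
Qed.

End Walks.

(** * Edge graph on the ranking points, and walks in it *)

Section PointGeometry.
Local Open Scope ring_scope.
Variables (R : realType) (n z : nat) (v : nat -> R) (P : set 'rV[R]_n).
Implicit Types (p q : {perm 'I_n}) (k l : nat) (i j r : 'I_n) (y : 'rV[R]_n).

(* [z] is 1 if b_1 = 1 and 0 otherwise; rankings have length at most [n - z], *)
(* so that the positive heights in use are those above [z].                   *)
Definition vpoint p k : 'rV[R]_n := \row_i v (height p k i).

Hypotheses (z1 : (z <= 1)%N) (zn : (z < n)%N) (vz : v z = v 0%N).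
Hypothesis vlt : forall i j : nat, (z <= i)%N -> (i < j)%N -> (j <= n)%N -> v i < v j.
Hypothesis Pmin : forall y i, P y -> v 0%N <= y 0 i.
Hypothesis Psum : forall p (m : nat) y, P y ->
  \sum_(r < n | (r < m)%N) y 0 (p r) <= \sum_(r < n | (r < m)%N) v (n - r)%N.
Hypothesis Ppoint : forall p k, (k + z <= n)%N -> P (vpoint p k).

Section Directions.
Variables (p : {perm 'I_n}) (k : nat).
Hypothesis kn : (k + z <= n)%N.
Let t := (0 < z)%N && (k + z == n)%N.

Definition edge_coef (t0 : bool) (j r : nat) : R :=
  if (j < k)%N then ((j.+1 < k)%N && (r == j.+1))%:R - (r == j)%:R
  else (r == j)%:R - (t0 && (r.+1 == k))%:R.

(** For [l < k] the facet bounds the sum of the first [l + 1] ranked coordinates; otherwise it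
    bounds one coordinate below. With [t0], the last of the sums runs over all coordinates: for b_1
    = 1 the bound on n - 1 coordinates follows from the total sum and the lower bound on the
    remaining one. *)
Definition facet_coef (t0 : bool) (r l : nat) : R :=
  if (l < k)%N then - ((r <= l)%N || t0 && (l.+1 == k))%:R else (r == l)%:R.

Definition edges : 'M[R]_n := \matrix_(j, i) edge_coef t j (p^-1%g i).
Definition facets : 'M[R]_n := \matrix_(i, l) facet_coef t (p^-1%g i) l.
Definition edge_length j : R :=
  if (j < k)%N then v (n - j)%N - v (if (j.+1 < k)%N then n - j.+1 else 0)%N
  else v (n - (k - t))%N - v 0%N.

Lemma sum_delta (m : nat) (f : nat -> R) :
  \sum_(r < n) (r == m :> nat)%:R * f r = if (m < n)%N then f m else 0.
Proof.
case: ltnP => mn.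
  rewrite (bigD1 (Ordinal mn)) //= eqxx mul1r big1 ?addr0 // => i.
  by rewrite -val_eqE /= => /negPf ->; rewrite mul0r.
by rewrite big1 // => i _; rewrite ltn_eqF ?mul0r // (leq_trans _ mn).
Qed.

Lemma sum_andb_delta (b : bool) (m : nat) (f : nat -> R) : (b -> (m < n)%N) ->
  \sum_(r < n) (b && (r == m :> nat))%:R * f r = if b then f m else 0.
Proof.
case: b => [/(_ isT) mn|_] /=; first by rewrite sum_delta mn.
by rewrite big1 // => i _; rewrite mul0r.
Qed.

Lemma edges_facets : edges *m facets = 1%:M.
Proof.
apply/matrixP => j l; rewrite !mxE.
under eq_bigr do rewrite !mxE.
rewrite (reindex_inj (@perm_inj _ p)) /=.
under eq_bigr do rewrite permK.
have jn := ltn_ord j; have ln := ltn_ord l.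
rewrite -val_eqE /= /edge_coef; case: (ltnP j k) => jk.
  under eq_bigr do rewrite mulrBl.
  rewrite big_split /= sumrN.
  rewrite (sum_andb_delta (facet_coef t ^~ l)); last by lia.
  rewrite (sum_delta _ (facet_coef t ^~ l)) jn /facet_coef.
  have -> (b : bool) (x : R) : (if b then x else 0) = b%:R * x.
    by case: b; rewrite ?mul1r ?mul0r.
  case: (ltnP l k) => lk.
    rewrite mulrN opprK -natrM addrC -natrB; last first.
      by move: kn; rewrite /t; lia.
    by congr _%:R; move: kn; rewrite /t; lia.
  rewrite -natrM.
  have -> : (j == l :> nat) = false by lia.
  have -> : ((j.+1 < k)%N * (j.+1 == l))%N = 0%N by lia.
  by rewrite subrr.
under eq_bigr do rewrite mulrBl.
rewrite big_split /= sumrN (sum_delta _ (facet_coef t ^~ l)) jn.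
have -> : \sum_(i < n) (t && (i.+1 == k))%:R * facet_coef t i l =
   if t then facet_coef t k.-1 l else 0.
  rewrite -(sum_andb_delta (facet_coef t ^~ l)); last by rewrite /t; lia.
  apply: eq_bigr => i _; congr (_%:R * _); congr (nat_of_bool _).
  by rewrite /t; lia.
rewrite /facet_coef.
have [t1|_] := boolP t; last first.
  rewrite subr0; case: (ltnP l k) => lk //=.
  have -> : (j <= l)%N = false by lia.
  by have -> : (j == l :> nat) = false; [lia|rewrite oppr0].
case: (ltnP l k) => lk.
  rewrite opprK addrC -natrB; last by move: t1; rewrite /t; lia.
  by congr _%:R; move: t1; rewrite /t; lia.
by rewrite (_ : (k.-1 == l) = false) ?subr0 //; move: t1; rewrite /t; lia.
Qed.

Lemma edge_length_gt0 j : 0 < edge_length j.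
Proof.
have jn := ltn_ord j; rewrite /edge_length; case: (ltnP j k) => jk.
  rewrite subr_gt0; case: (ltnP j.+1 k) => j1k; last rewrite -vz.
    by apply: vlt; move: kn; lia.
  by apply: vlt; move: kn; lia.
by rewrite subr_gt0 -vz; apply: vlt; move: kn; rewrite /t; lia.
Qed.

Lemma point_neighbor j :
  vpoint p k + edge_length j *: row j edges =
  vpoint (neighbor t p k j).1 (neighbor t p k j).2.
Proof.
apply/rowP; apply: (perm_forall (p := p)) => r; have rn := ltn_ord r.
have jn := ltn_ord j; rewrite !mxE permK heightE /edge_coef /edge_length.
rewrite /neighbor; case: (ltnP j k) => jk.
  case: (ltnP j.+1 k) => jk1 /=.
    have vj' := val_insubd_ord j (leq_trans jk1 (leq_trans (leq_addr _ _) kn)).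
    rewrite height_tperm; case: tpermP => [->|->|/eqP rj /eqP rj'].
    - rewrite vj' jk jk1 eqxx (_ : (j == j.+1 :> nat) = false); last by lia.
      by rewrite /=; ring.
    - rewrite vj' jk jk1 eqxx (_ : (j.+1 == j :> nat) = false); last by lia.
      by rewrite /=; ring.
    - rewrite -vj' !val_eqE (negPf rj) (negPf rj'); by rewrite /=; ring.
  rewrite heightE; have [rj|rj] := eqVneq (r : nat) j.
    by rewrite rj jk ifF; [rewrite /=; ring|lia].
  rewrite sub0r oppr0 mulr0 addr0; congr (v _).
  by do 2 case: ifP; lia.
set a := insubd j _.
have [t1|t0] := boolP t; rewrite /= ?addn0 ?addn1 height_tperm.
  have va : a = k.-1 :> nat by rewrite /a val_insubd_ord t1; lia.
  have rk b : (b.+1 == k) = (b == a :> nat) by move: t1; rewrite /t va; lia.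
  have ak : (a < k)%N by rewrite va; move: t1; rewrite /t; lia.
  have na : (n - (k - 1) = n - a)%N by rewrite va; lia.
  rewrite rk na; case: tpermP => [->|->|/eqP ra /eqP rj].
  - rewrite ak eqxx ifF; last by lia.
    by rewrite (_ : (a == j :> nat) = false); [rewrite /=; ring|lia].
  - rewrite ak eqxx ifF; last by lia.
    by rewrite (_ : (j == a :> nat) = false); [rewrite /=; ring|lia].
  by rewrite !val_eqE (negPf ra) (negPf rj); rewrite /=; ring.
have va : a = k :> nat by rewrite /a val_insubd_ord (negPf t0); lia.
rewrite subn0 -va; case: tpermP => [->|rj|/eqP ra /eqP rj].
- rewrite ltnn; have [aj|aj] := eqVneq (a : nat) j.
    by rewrite -aj ltnSn; rewrite /=; ring.
  by rewrite ifF; [rewrite /=; ring|lia].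
- by rewrite rj eqxx ltnSn ifF; [rewrite /=; ring|lia].
have {}ra : r != a :> nat by [].
have {}rj : (r == j :> nat) = false by exact: negPf rj.
rewrite rj subrr mulr0 addr0; congr (v _).
by do 2 case: ifP; lia.
Qed.

Lemma facet_ge0 y (l : 'I_n) : P y -> 0 <= ((y - vpoint p k) *m facets) 0 l.
Proof.
move=> Py; have ln := ltn_ord l; rewrite !mxE (reindex_inj (@perm_inj _ p)) /=.
under eq_bigr do rewrite !mxE permK heightE /facet_coef.
case: (ltnP l k) => lk; last first.
  apply: sumr_ge0 => r _; have [->|rl] := eqVneq (r : nat) l.
    by rewrite ifF ?mulr1 ?subr_ge0 ?Pmin //; lia.
  by rewrite mulr0.
pose B r := (r <= l)%N || t && (l.+1 == k).
have -> : \sum_(r < n) (y 0 (p r) - v (if (r < k)%N then n - r else 0)%N) *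
     - (B r)%:R = \sum_(r < n | B r) v (n - r)%N - \sum_(r < n | B r) y 0 (p r).
  rewrite -sumrB [RHS]big_mkcond /=; apply: eq_bigr => r _.
  have rn := ltn_ord r.
  have [Br|_] := boolP (B r); last by rewrite /= mulr0n oppr0 mulr0.
  rewrite mulrN1 opprB; congr (_ - _); case: ltnP => // kr.
  (* An unranked position enters the sum only under [t]; it is the last one, of height 1 = [z],
     where [v] agrees with [v 0]. *)
  rewrite -vz; congr v; move: Br; rewrite /B /t; move: z1 kn; lia.
rewrite subr_ge0; have [m Bm] : exists m, forall r : 'I_n, B r = (r < m)%N.
  rewrite /B; case: (t && _); [exists n|exists l.+1] => r.
    by rewrite orbT ltn_ord.
  by rewrite orbF ltnS.
by rewrite !(eq_bigl _ _ Bm); exact: Psum.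
Qed.

Lemma point_simple : simple_at P (vpoint p k) edges facets edge_length.
Proof.
split.
- exact: Ppoint.
- exact: edges_facets.
- exact: edge_length_gt0.
- move=> j; rewrite point_neighbor; apply: Ppoint.
  have jn := ltn_ord j.
  rewrite /neighbor /t; case: ltnP => jk; last by rewrite /=; move: z1 kn; lia.
  by case: ifP => _ /=; move: kn; lia.
- by move=> y l; exact: facet_ge0.
Qed.

Lemma point_vertex : is_vertex P (vpoint p k).
Proof. exact: simple_at_vertex point_simple. Qed.

End Directions.
Let nb p k := neighbor ((0 < z)%N && (k + z == n)%N) p k.

Lemma neighbor_le p k j : (k + z <= n)%N -> ((nb p k j).2 + z <= n)%N.
Proof.
move=> kn; have jn := ltn_ord j; rewrite /nb /neighbor.
case: ltnP => jk; last by rewrite /=; move: z1 kn; lia.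
by case: ifP => _ /=; move: kn; lia.
Qed.

Lemma vertex_point x : is_vertex P x ->
  exists p k, (k + z <= n)%N /\ x = vpoint p k.
Proof.
move=> vx.
pose pt (q : {perm 'I_n} * 'I_(n - z).+1) := vpoint q.1 q.2.
have le (q : {perm 'I_n} * 'I_(n - z).+1) : (q.2 + z <= n)%N.
  by have := ltn_ord q.2; move: zn; lia.
have [|[p k] ->] := @vertex_in_simple_family R n _ (1%g, ord0) P pt x _ vx; last first.
  by exists p, k; split => //; exact: (le (p, k)).
move=> [p k]; have kn := le (p, k).
exists (edges p k), (facets p k), (edge_length k); split; first exact: point_simple.
move=> j; rewrite point_neighbor //; have nl := neighbor_le p j kn.
have lt : ((nb p k j).2 < (n - z).+1)%N by rewrite ltnS leq_subRL 1?addnC // ltnW.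
by exists ((nb p k j).1, Ordinal lt).
Qed.

Lemma point_adjacent_inv p k y : (k + z <= n)%N -> adjacent P (vpoint p k) y ->
  exists j, y = vpoint (nb p k j).1 (nb p k j).2.
Proof.
move=> kn /(simple_at_adjacent_inv (point_simple p kn)) [j|j ->].
  by rewrite point_neighbor //; apply: point_vertex; exact: neighbor_le.
by exists j; rewrite point_neighbor.
Qed.

Lemma point_adjacent p k j : (k + z <= n)%N ->
  adjacent P (vpoint p k) (vpoint (nb p k j).1 (nb p k j).2).
Proof.
move=> kn; have := point_neighbor p kn j; rewrite -/(nb _ _ _) => <-.
apply: simple_at_adjacent (point_simple p kn) _ _.
by rewrite point_neighbor //; apply: point_vertex; exact: neighbor_le.
Qed.

(** [v] identifies only the heights 0 and [z], and rankings of length at most [n - z] use no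
    positive height up to [z]. *)
Lemma point_height p k q l : (k + z <= n)%N -> (l + z <= n)%N ->
  vpoint p k = vpoint q l -> height p k =1 height q l.
Proof.
move=> kn ln /rowP pq i; have := pq i; rewrite !mxE.
have hz p' k' : (k' + z <= n)%N ->
    height p' k' i = 0%N \/ (z < height p' k' i <= n)%N.
  move=> kn'; rewrite /height; case: ltnP => rk; last by left.
  by right; have := ltn_ord (p'^-1%g i); move: kn' rk; lia.
have vmono (a b : nat) : (b <= n)%N -> b = 0%N \/ (z < b)%N -> (a < b)%N ->
    a = 0%N \/ (z < a)%N -> v a < v b.
  move=> bn hb ab [->|za]; last by apply: vlt => //; exact: ltnW.
  by rewrite -vz; apply: vlt => //; move: hb ab; lia.
move=> vh; have := hz p k kn; have := hz q l ln; move: vh.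
set a := height p k i; set b := height q l i => vh hb ha.
have {}ha : (a <= n)%N /\ (a = 0%N \/ (z < a)%N) by move: ha; lia.
have {}hb : (b <= n)%N /\ (b = 0%N \/ (z < b)%N) by move: hb; lia.
have [ab|ba|//] := ltngtP a b.
  by have := vmono a b hb.1 hb.2 ab ha.2; rewrite vh ltxx.
by have := vmono b a ha.1 ha.2 ba hb.2; rewrite vh ltxx.
Qed.

(** At the end of the walk [M] is the support of the target and the cost is zero. *)
Lemma cost_bound_walk p k q l s : (k + z <= n)%N -> (l + z <= n)%N ->
  ((0 < z)%N -> (l + z = n)%N) -> edge_path P (vpoint p k) (vpoint q l) s ->
  cost_bound (height q l) (0 < z)%N (height p k) (size s).
Proof.
move=> kn ln lz; elim: s p k kn => [|y s IH] p k kn [] /=.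
  move=> _ /(point_height kn ln) pq.
  exists [set i | (0 < height q l i)%N]; last first.
    by left => i; rewrite inE pq.
  rewrite /cost !big1 // => i _.
    rewrite big1 // => j _; rewrite /pair_cost !inE !pq.
    by case: ifP => // hj; case: ifP => hi; lia.
  by rewrite /supp_cost inE pq; case: posnP.
move=> /andP[/asboolP/(point_adjacent_inv kn) [j ->]] ps ls.
apply: (@cost_bound_move _ _ _ _ (height (nb p k j).1 (nb p k j).2)).
- move=> z0; have kn' : (k < n)%N by move: kn; lia.
  by exists (p (Ordinal kn')); rewrite heightE ltnn.
- move=> z0; have ln' : (l < n)%N by have := lz z0; lia.
  exists (q (Ordinal ln')); first by rewrite heightE ltnn.
  apply: (perm_forall (p := q)) => r; rewrite (inj_eq perm_inj) -val_eqE /= => rl.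
  by rewrite heightE; have := lz z0; have := ltn_ord r; case: ifP; move: z1; lia.
- exact: neighbor_move.
- by apply: IH; [exact: neighbor_le|split].
Qed.

Lemma adjacent_sym x y : adjacent P x y -> adjacent P y x.
Proof.
move=> [vx vy xy [E [eE Ex Ey]]]; split => //; first by move=> h; apply: xy.
by exists E.
Qed.

Lemma adjacent_delete p k : (k.+1 + z <= n)%N ->
  adjacent P (vpoint p k.+1) (vpoint p k).
Proof.
move=> kn; have kn' : (k < n)%N by move: kn; lia.
have := @point_adjacent p k.+1 (Ordinal kn') kn.
by rewrite /nb /neighbor /= ltnSn ltnn.
Qed.

Lemma within_delete p k m : (k + m + z <= n)%N ->
  within P (vpoint p (k + m)) (vpoint p k) m.
Proof.
elim: m => [|m IH] kn; first by rewrite addn0; exact: within_refl.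
rewrite -[X in within _ _ _ X]add1n.
apply: within_trans (within1 _) (IH _); last by move: kn; lia.
by rewrite addnS; apply: adjacent_delete; rewrite -addnS.
Qed.

Lemma within_append p k m : (k + m + z <= n)%N ->
  within P (vpoint p k) (vpoint p (k + m)) m.
Proof.
elim: m => [|m IH] kn; first by rewrite addn0; exact: within_refl.
rewrite -[X in within _ _ _ X]addn1.
apply: within_trans (IH _) (within1 _); first by move: kn; lia.
by rewrite addnS; apply/adjacent_sym/adjacent_delete; rewrite -addnS.
Qed.

Lemma point0 p q : vpoint p 0 = vpoint q 0.
Proof. by apply/rowP => i; rewrite !mxE /height !ltn0. Qed.

Lemma within_via_min p q k l : (k + z <= n)%N -> (l + z <= n)%N ->
  within P (vpoint p k) (vpoint q l) (k + l).
Proof.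
move=> kn ln; apply: within_trans (@within_delete p 0 k kn) _.
by rewrite (point0 p q); exact: (@within_append q 0 l).
Qed.

(** For [z] = 1 the last two positions are exchanged by the replacing edge, which makes all adjacent
    transpositions available. *)
Lemma adjacent_swap p k (a b : 'I_n) : (k + z = n)%N -> b = a.+1 :> nat ->
  adjacent P (vpoint p k) (vpoint (tperm a b * p)%g k).
Proof.
move=> kn ba; have an := ltn_ord a; have bn := ltn_ord b.
have kn' : (k + z <= n)%N by rewrite kn.
have [bk|kb] := ltnP b k.
  have := point_adjacent p a kn'; rewrite /nb /neighbor -ba bk ifT; last by lia.
  suff -> : insubd a b = b :> 'I_n by [].
  by apply: val_inj; rewrite /= val_insubd_ord // ba.
have := point_adjacent p b kn'.
rewrite /nb /neighbor ltnNge kb kn eqxx andbT.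
have -> : (0 < z)%N by move: kn kb bn z1; lia.
rewrite /= addn0; suff -> : insubd b (k - 1)%N = a by [].
by apply: val_inj; rewrite /= val_insubd_ord; move: kn kb ba z1; lia.
Qed.

Lemma within_bring p k (a b : 'I_n) : (k + z = n)%N -> (a <= b)%N ->
  exists q, [/\ within P (vpoint p k) (vpoint q k) (b - a), q a = p b &
    forall r : 'I_n, (r < a)%N -> q r = p r].
Proof.
move=> kn; move db : (b - a)%N => d; elim: d p b db => [|d IH] p b db ab.
  have <- : a = b by apply: val_inj; rewrite /=; lia.
  by exists p; split => //; exact: within_refl.
have bn : (b.-1 < n)%N by have := ltn_ord b; lia.
pose b' := Ordinal bn.
have [||q [wq qa qr]] := IH (tperm b' b * p)%g b'; rewrite /=; try by lia.
exists q; split.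
- rewrite -[X in within _ _ _ X]add1n; apply: within_trans wq; apply: within1.
  by apply: adjacent_swap => //=; lia.
- by rewrite qa permM tpermL.
- move=> r ra; rewrite qr // permM tpermD // -val_eqE /=; lia.
Qed.

Lemma within_sort m p q k : (k + z = n)%N -> (m <= n)%N ->
  (forall r : 'I_n, (r < n - m)%N -> p r = q r) ->
  within P (vpoint p k) (vpoint q k) 'C(m, 2).
Proof.
move=> kn; elim: m p => [|m IH] p mn pq.
  have -> : p = q by apply/permP => r; apply: pq; rewrite subn0.
  exact: within_refl.
have an : (n - m.+1 < n)%N by lia.
pose a := Ordinal an; pose b := (p^-1)%g (q a).
have ab : (a <= b)%N.
  rewrite leqNgt; apply/negP => ba.
  have := pq b ba; rewrite /b permKV => /perm_inj ab.
  by move: ba; rewrite -/b /b -ab ltnn.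
have [p' [wp p'a p'r]] := within_bring p kn ab.
rewrite binS bin1 addnC.
apply: within_trans (within_le (_ : (b - a <= m)%N) wp) (IH p' _ _); try lia.
  by have := ltn_ord b; rewrite /a /=; lia.
move=> r rm; have [ra|ra] := eqVneq r a; first by rewrite ra p'a /b permKV.
have rlt : (r < a)%N by move: ra; rewrite -val_eqE /=; lia.
by rewrite p'r // pq.
Qed.

Lemma within_full p q k : (k + z = n)%N ->
  within P (vpoint p k) (vpoint q k) 'C(n, 2).
Proof. by move=> kn; apply: within_sort => // r; rewrite subnn. Qed.

End PointGeometry.

(** * The parking function polytope *)

Section ReversedCost.
Local Open Scope nat_scope.
Variables (T : finType) (h t : T -> nat).
Hypothesis hinj : forall i j, i != j -> (h j < h i) + (h i < h j) = 1.
Hypothesis rev : forall i j, (h j < h i) = (t i < t j).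
Implicit Types (M : {set T}).

Lemma card_sum (A : {set T}) : #|A| = \sum_i (i \in A).
Proof. by rewrite -sum1_card big_mkcond; apply: eq_bigr => i _; case: (i \in A). Qed.

(** Every unordered pair meeting [M] costs exactly one and all others nothing, which gives C(n,2) -
    C(c,2) with c the size of the complement. *)
Lemma pair_cost_reversed M :
  2 * (\sum_i \sum_j pair_cost t M h i j) + #|~: M| ^ 2 + #|M| = #|T| ^ 2.
Proof.
have -> : #|T| ^ 2 = \sum_(i : T) \sum_(j : T) 1.
  by rewrite !sum_nat_const muln1 -mulnn.
have -> : #|~: M| ^ 2 = \sum_i \sum_j (i \notin M) * (j \notin M).
  rewrite -mulnn card_sum big_distrlr /=.
  by apply: eq_bigr => i _; apply: eq_bigr => j _; rewrite !inE.
have -> : #|M| = \sum_i \sum_j ((i == j) && (j \in M)).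
  rewrite card_sum; apply: eq_bigr => i _.
  rewrite (bigD1 i) //= eqxx big1 ?addn0 // => j ji.
  by rewrite eq_sym (negPf ji).
rewrite mul2n -addnn {2}exchange_big /= -!big_split /=.
apply: eq_bigr => i _; rewrite -!big_split /=; apply: eq_bigr => j _.
rewrite /pair_cost -!rev; have [->|ij] := eqVneq i j.
  by rewrite ltnn; case: (j \in M).
have := hinj ij; case: (i \in M); case: (j \in M) => //=; clear; lia.
Qed.

Lemma cost_reversed M :
  #|T| ^ 2 + 4 * #|~: M| <=
  2 * (cost t M h + #|[set i | h i == 0]| + #|[set i | t i == 0]|)
  + #|~: M| ^ 2 + #|M|.
Proof.
rewrite -(pair_cost_reversed M).
suff : 2 * #|~: M| <= \sum_i supp_cost t M h i + #|[set i | h i == 0]|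
    + #|[set i | t i == 0]| by rewrite /cost; lia.
rewrite !card_sum mul2n -addnn -!big_split /=; apply: leq_sum => i _.
by rewrite /supp_cost !inE; case: (i \in M) => //=; lia.
Qed.

End ReversedCost.

(** * The identity ranking and its reversal *)

Section ReversedHeights.
Local Open Scope nat_scope.
Variable n : nat.
Implicit Types (k l : nat) (i j : 'I_n).

Definition rev_perm : {perm 'I_n} := perm (@rev_ord_inj n).

Lemma height1 k i : height 1%g k i = if i < k then n - i else 0.
Proof. by rewrite -{1}(perm1 i) heightE. Qed.

Lemma height_rev l i : height rev_perm l i = if n <= i + l then i.+1 else 0.
Proof.
have {1}-> : i = rev_perm (rev_ord i) by rewrite permE rev_ordK.
rewrite heightE /=; have := ltn_ord i.
by do 2 case: ifP; lia.
Qed.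

Lemma heights_reversed k l i j : n <= k.+1 -> n <= l.+1 ->
  (height 1%g k j < height 1%g k i) = (height rev_perm l i < height rev_perm l j).
Proof.
move=> nk nl; rewrite !height1 !height_rev.
have := ltn_ord i; have := ltn_ord j.
by case: (ltnP i k); case: (ltnP j k); case: (leqP n (i + l)); case: (leqP n (j + l)); lia.
Qed.

Lemma height1_inj k i j : n <= k.+1 -> i != j ->
  (height 1%g k j < height 1%g k i) + (height 1%g k i < height 1%g k j) = 1.
Proof.
move=> nk; rewrite -val_eqE /= !height1.
have := ltn_ord i; have := ltn_ord j.
by case: (ltnP i k); case: (ltnP j k); lia.
Qed.

Lemma card_le1 (A : {set 'I_n}) (m : nat) :
  (forall i, i \in A -> i = m :> nat) -> #|A| <= 1.
Proof.
move=> Am; apply/card_le1_eqP => i j /Am im /Am jm.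
by apply: val_inj; rewrite /= im jm.
Qed.

Lemma card_zeros_height1 k : n <= k.+1 -> #|[set i : 'I_n | height 1%g k i == 0]| <= n - k.
Proof.
move=> nk; have [kn|nk'] := ltnP k n.
  apply: leq_trans (@card_le1 _ n.-1 _) _; last by lia.
  by move=> i; rewrite inE height1; have := ltn_ord i; case: (ltnP i k); lia.
rewrite (_ : [set _ | _] = finset.set0) ?cards0 //; apply/setP => i; rewrite !inE height1.
by have := ltn_ord i; case: (ltnP i k); lia.
Qed.

Lemma card_zeros_height_rev l : n <= l.+1 -> #|[set i : 'I_n | height rev_perm l i == 0]| <= n - l.
Proof.
move=> nl; have [ln|nl'] := ltnP l n.
  apply: leq_trans (@card_le1 _ 0 _) _; last by lia.
  by move=> i; rewrite inE height_rev; have := ltn_ord i; case: (leqP n (i + l)); lia.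
rewrite (_ : [set _ | _] = finset.set0) ?cards0 //; apply/setP => i; rewrite !inE height_rev.
by have := ltn_ord i; case: (leqP n (i + l)); lia.
Qed.

Lemma cost_reversed_heights k l M : n <= k.+1 -> n <= l.+1 ->
  n ^ 2 + 4 * #|~: M| <=
  2 * (cost (height rev_perm l) M (height 1%g k) + (n - k) + (n - l))
  + #|~: M| ^ 2 + #|M|.
Proof.
move=> nk nl; rewrite -{1}(card_ord n).
apply: leq_trans (@cost_reversed _ (height 1%g k) (height rev_perm l) _ _ M) _.
- by move=> i j; exact: height1_inj.
- by move=> i j; exact: heights_reversed.
rewrite !leq_add2r leq_mul2l /= -!(addnA (cost _ _ _)); apply: leq_add (leqnn _) _; apply: leq_add.
  exact: card_zeros_height1.
exact: card_zeros_height_rev.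
Qed.

(* [c] is the number of entries which are not kept; they include the zeros of *)
(* both heights.                                                              *)
Lemma cost_bound_reversed (z : bool) k l m : n <= k.+1 -> n <= l.+1 ->
  (k < n -> l < n -> 1 < n) ->
  cost_bound (height rev_perm l) z (height 1%g k) m ->
  z /\ n * n.-1 <= 2 * m \/ exists c, [/\ (n - k) + (n - l) <= c, c <= n &
    n * n.-1 + 5 * c <= 2 * (m + (n - k) + (n - l)) + c ^ 2].
Proof.
move=> nk nl n1 [M cM kept].
have Mn : #|M| + #|~: M| = n by rewrite cardsC card_ord.
have nn : n ^ 2 = n * n.-1 + n by rewrite -mulnn; case: (n) => // ?; rewrite mulnS addnC.
case: kept => [kept|[zT MT _]].
  right; exists #|~: M|; split; last 2 first.
  - by move: Mn; lia.
  - by have := @cost_reversed_heights k l M nk nl; rewrite nn; move: cM Mn; lia.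
  have hk (kn : k < n) : Ordinal kn \in ~: M.
    by rewrite inE; apply/negP => /kept; rewrite height1 ltnn; case.
  have hl (ln : l < n) (n0 : 0 < n) : Ordinal n0 \in ~: M.
    by rewrite inE; apply/negP => /kept [_]; rewrite height_rev /= add0n ifN // -ltnNge.
  have [kn|kn] := ltnP k n; have [ln|ln] := ltnP l n.
  - have n0 : 0 < n by lia.
    (* The identity leaves the last coordinate unranked and the reversal the first; they differ as
       [1 < n]. *)
    apply: leq_trans (_ : #|[set Ordinal kn; Ordinal n0]| <= _).
      by rewrite cards2 -val_eqE /=; have := n1 kn ln; lia.
    by apply/subset_leq_card/fintype.subsetP => i; rewrite !inE => /orP[]/eqP ->; have := hk kn; have := hl ln n0; rewrite !inE.
  - apply: leq_trans (_ : 1 <= _); first by lia.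
    by apply/card_gt0P; exists (Ordinal kn).
  - have n0 : 0 < n by lia.
    apply: leq_trans (_ : 1 <= _); first by lia.
    by apply/card_gt0P; exists (Ordinal n0); exact: hl.
  - by lia.
left; split => //; have MC : #|~: M| = 0 by move: Mn; rewrite MT cardsT card_ord; lia.
have := @pair_cost_reversed _ (height 1%g k) (height rev_perm l)
  (fun i j => height1_inj nk) (fun i j => heights_reversed _ _ nk nl) M.
rewrite card_ord MC addn0 => h.
have : 2 * cost (height rev_perm l) M (height 1%g k) <= 2 * m by rewrite leq_mul2l.
by rewrite /cost; move: h Mn; rewrite MC nn; lia.
Qed.

End ReversedHeights.

(** * Inequalities and ranking points of the parking function polytope *)

Section ParkingPolytope.
Local Open Scope ring_scope.
Variables (R : realType) (n : nat) (b : 'I_n -> nat).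
Hypothesis hb : forall i, (0 < b i)%N.
Implicit Types (p q : {perm 'I_n}) (k l m : nat) (i j r : 'I_n) (y : 'rV[R]_n).

(* The bound B_h = b_1 + ... + b_h; height [0] stands for the entry 1.        *)
Definition value (h : nat) : nat :=
  if h is 0%N then 1%N else (\sum_(j < n | (j < h)%N) b j)%N.

Lemma value_lt m l : (0 < m)%N -> (m < l)%N -> (l <= n)%N -> (value m < value l)%N.
Proof.
case: m => // m _ ml ln; case: l ml ln => // l ml ln; rewrite /value.
have mn : (m.+1 < n)%N by lia.
rewrite [X in (_ < X)%N](bigID (fun j : 'I_n => j < m.+1)%N) /=.
rewrite [X in (_ < X + _)%N](eq_bigl (fun j : 'I_n => j < m.+1)%N); last by move=> j; lia.
rewrite -[X in (X < _)%N]addn0 ltn_add2l (bigD1 (Ordinal mn)) /=; last by rewrite ltnn ml.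
by rewrite ltn_addr.
Qed.

Lemma value0_le l : (l <= n)%N -> (value 0 <= value l)%N.
Proof.
case: l => // l ln; rewrite /value (bigD1 (Ordinal ln)) //=.
exact: ltn_addr.
Qed.

Lemma value_le m l : (m <= l)%N -> (l <= n)%N -> (value m <= value l)%N.
Proof.
case: m => [|m]; first by move=> _; exact: value0_le.
by rewrite leq_eqVlt => /orP[/eqP <-//|ml ln]; apply: ltnW; exact: value_lt.
Qed.

(** After subtracting the threshold [s m], terms with [q r < m] are nonnegative and the others
    nonpositive, so the first [m] indices are the best choice. *)
Lemma sum_perm_le (s : nat -> R) q m :
  (forall i j : nat, (i <= j)%N -> s j <= s i) ->
  \sum_(r < n | (r < m)%N) s (q r) <= \sum_(r < n | (r < m)%N) s r.
Proof.
move=> smono; rewrite -subr_ge0.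
pose c := s m.
have shift (f : 'I_n -> R) : \sum_(r < n | (r < m)%N) f r =
    \sum_(r < n | (r < m)%N) (f r - c) + \sum_(r < n | (r < m)%N) c.
  by rewrite -big_split /=; apply: eq_bigr => r _; rewrite subrK.
rewrite (shift (fun r => s (q r))) (shift (fun r => s r)) opprD addrACA subrr addr0.
rewrite [X in X - _](reindex_inj (@perm_inj _ q)) /=.
rewrite big_mkcond [X in _ - X]big_mkcond /= -sumrB; apply: sumr_ge0 => r _.
have [qm|qm] := ltnP (q r) m.
  have : c <= s (q r) by apply: smono; exact: ltnW.
  by case: ifP => _; rewrite ?subrr // subr0 subr_ge0.
have : s (q r) <= c by exact: smono.
by case: ifP => _; rewrite sub0r ?oppr0 // oppr_ge0 subr_le0.
Qed.

Lemma parking_le_perm (beta : n.-tuple nat) : is_parking_function b beta ->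
  exists q : {perm 'I_n}, forall i, (tnth beta i <= value (q i).+1)%N.
Proof.
move=> [_ hs].
have : perm_eq beta (sort_tuple leq beta) by rewrite perm_sym perm_sort.
case/tuple_permP => q bq; exists q => i.
have -> : tnth beta i = nth 0%N (sort leq beta) (q i).
  by rewrite (tnth_nth 0%N) {1}bq nth_mktuple (tnth_nth 0%N).
by apply: leq_trans (hs (q i)) _; rewrite /value.
Qed.

Let v h : R := (value h)%:R.

Lemma polytope_min y i : parking_polytope R b y -> v 0%N <= y 0 i.
Proof.
pose c : 'cV[R]_n := \col_j - (j == i)%:R.
have yc (x : 'rV[R]_n) : (x *m c) 0 0 = - x 0 i.
  rewrite mxE (bigD1 i) //= mxE eqxx mulrN1 big1 ?addr0 // => j ji.
  by rewrite mxE (negPf ji) oppr0 mulr0.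
move=> Py; rewrite -lerN2 -yc; apply: convex_hull_halfspace Py.
move=> x [beta [[beta0 _] ->]]; rewrite yc mxE lerN2 ler_nat.
exact: beta0.
Qed.

Lemma polytope_sum p m y : parking_polytope R b y ->
  \sum_(r < n | (r < m)%N) y 0 (p r) <= \sum_(r < n | (r < m)%N) v (n - r)%N.
Proof.
pose c : 'cV[R]_n := \col_j ((p^-1)%g j < m)%N%:R.
have yc (x : 'rV[R]_n) : (x *m c) 0 0 = \sum_(r < n | (r < m)%N) x 0 (p r).
  rewrite mxE (reindex_inj (@perm_inj _ p)) [RHS]big_mkcond /=.
  apply: eq_bigr => r _; rewrite mxE permK.
  by case: ifP; rewrite ?mulr1 ?mulr0.
rewrite -yc; apply: convex_hull_halfspace => x [beta [hbeta ->]]; rewrite yc.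
have [q hq] := parking_le_perm hbeta.
pose q' := (p * q * rev_perm n)%g.
apply: le_trans (_ : \sum_(r < n | (r < m)%N) v (n - q' r)%N <= _).
  apply: ler_sum => r _; rewrite mxE ler_nat (leq_trans (hq _)) //.
  rewrite /q' !permM permE /= subKn //.
have vmono (i j : nat) : (i <= j)%N -> v (n - j)%N <= v (n - i)%N.
  by move=> ij; rewrite ler_nat value_le //; lia.
exact: (@sum_perm_le (fun h : nat => v (n - h)%N) q' m vmono).
Qed.

Lemma polytope_point p k : (k <= n)%N -> parking_polytope R b (vpoint v p k).
Proof.
move=> kn; apply: sub_gen_smallest.
exists [tuple value (height p k i) | i < n]; split; last first.
  by apply/rowP => i; rewrite !mxE tnth_mktuple.
have hn i : (height p k i <= n)%N by rewrite /height; case: ifP => // _; lia.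
split=> i; first by rewrite tnth_mktuple; exact: (value0_le (hn i)).
(* The sorted entries: n - k ones, followed by B_(n-k+1), ..., B_n. *)
pose f (j : nat) := value (if (j < n - k)%N then 0%N else j.+1).
have gle (j : 'I_n) : (f j <= value j.+1)%N.
  by rewrite /f; apply: value_le => //; case: ifP.
suff -> : sort leq [tuple value (height p k i) | i < n] = mkseq f n.
  by rewrite nth_mkseq //; exact: gle.
apply: (sorted_eq leq_trans anti_leq).
- by apply: sort_sorted; exact: leq_total.
- apply/(sortedP 0%N) => j; rewrite size_mkseq => jn.
  rewrite !nth_mkseq //; last exact: ltnW.
  by rewrite /f; apply: value_le; last (by case: ifP); do 2 case: ifP; lia.
rewrite perm_sort.
have -> : mkseq f n = [tuple f i | i < n] :> seq nat.
  by rewrite /= /mkseq -val_enum_ord -map_comp.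
apply/tuple_permP; exists (p^-1 * rev_perm n)%g.
congr (tval _); apply: eq_from_tnth => j; rewrite !tnth_mktuple permM permE /f /height /=.
congr value; have := ltn_ord ((p^-1)%g j).
by do 2 case: ifP; lia.
Qed.

Variable hn : (0 < n)%N.
Hypothesis hne : ~ (n = 1%N /\ b (Ordinal hn) = 1%N).

Let z : nat := b (Ordinal hn) == 1%N.

Lemma value1 : value 1 = b (Ordinal hn).
Proof.
rewrite /value (bigD1 (Ordinal hn)) //= big1 ?addn0 // => j.
by rewrite -val_eqE /= => /andP[]; case: (j : nat).
Qed.

Let z1 : (z <= 1)%N. Proof. by rewrite /z; case: (_ == _). Qed.

Let zn : (z < n)%N.
Proof.
rewrite /z; case: eqP => // b1; rewrite ltn_neqAle hn andbT eq_sym.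
by apply/eqP => n1; apply: hne.
Qed.

Let vz : v z = v 0%N.
Proof. by rewrite /z /v; case: eqP => // b1; rewrite -[nat_of_bool true]/1%N value1 b1. Qed.

Let vlt (i j : nat) : (z <= i)%N -> (i < j)%N -> (j <= n)%N -> v i < v j.
Proof.
move=> zi ij jn; rewrite ltr_nat; case: i zi ij => [|i] zi ij; last exact: value_lt.
have b1 : (1 < b (Ordinal hn))%N.
  by rewrite ltn_neqAle hb andbT eq_sym; move: zi; rewrite /z; case: eqP.
by apply: leq_trans (value_le ij jn); rewrite value1.
Qed.

Let Ppoint p k : (k + z <= n)%N -> parking_polytope R b (vpoint v p k).
Proof. by move=> kn; apply: polytope_point; lia. Qed.

Let P := parking_polytope R b.

Let Pmin y i : P y -> v 0%N <= y 0 i. Proof. exact: polytope_min. Qed.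

Let Psum p m y : P y ->
  \sum_(r < n | (r < m)%N) y 0 (p r) <= \sum_(r < n | (r < m)%N) v (n - r)%N.
Proof. exact: polytope_sum. Qed.

Lemma polytope_diameter (d k0 l0 : nat) :
  (forall p q k l, (k + z <= n)%N -> (l + z <= n)%N ->
     (k + l <= d)%N \/
     exists (k' : nat), [/\ (k' + z = n)%N, (k <= k')%N, (l <= k')%N &
       ((k' - k) + ('C(n, 2) + (k' - l)) <= d)%N]) ->
  (k0 + z <= n)%N -> (l0 + z <= n)%N -> (n <= k0.+1)%N -> (n <= l0.+1)%N ->
  ((0 < z)%N -> (l0 + z = n)%N) -> (k0 < n -> l0 < n -> 1 < n)%N ->
  (forall m, (0 < z)%N /\ (n * n.-1 <= 2 * m)%N \/
     (exists c, [/\ (n - k0) + (n - l0) <= c, c <= n &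
        n * n.-1 + 5 * c <= 2 * (m + (n - k0) + (n - l0)) + c ^ 2])%N ->
     (d <= m)%N) ->
  is_combinatorial_diameter P d.
Proof.
move=> up k0n l0n nk0 nl0 zl0 n1 low; apply: diameter_intro.
  move=> x y /(vertex_point z1 zn vz vlt Pmin Psum Ppoint) [p [k [kn ->]]].
  move=> /(vertex_point z1 zn vz vlt Pmin Psum Ppoint) [q [l [ln ->]]].
  have [kl|[k' [k'n kk' lk' kd]]] := up p q k l kn ln.
    apply: within_le kl _.
    exact: (within_via_min z1 zn vz vlt Pmin Psum Ppoint).
  have k'n' : (k' + z <= n)%N by rewrite k'n.
  apply: within_le kd _; apply: within_trans (_ : within P _ (vpoint v p k') _) _.
    rewrite -{1}(subnKC kk'); apply: (within_append z1 zn vz vlt Pmin Psum Ppoint).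
    by rewrite subnKC.
  apply: within_trans (within_full z1 zn vz vlt Pmin Psum Ppoint p q k'n) _.
  rewrite -{1}(subnKC lk'); apply: (within_delete z1 zn vz vlt Pmin Psum Ppoint).
  by rewrite subnKC.
exists (vpoint v 1%g k0), (vpoint v (rev_perm n) l0); split.
- exact: (point_vertex z1 zn vz vlt Pmin Psum Ppoint).
- exact: (point_vertex z1 zn vz vlt Pmin Psum Ppoint).
move=> s /(cost_bound_walk z1 zn vz vlt Pmin Psum Ppoint k0n l0n zl0).
by move=> /(cost_bound_reversed nk0 nl0 n1)/low.
Qed.

End ParkingPolytope.

(** * Arithmetic of the two cases *)

Lemma double_bin2 n : (2 * 'C(n, 2) = n * n.-1)%N.
Proof. by rewrite mulnC -[X in ('C(n, 2) * X)%N]/(2`!) bin_ffact ffactnS ffactn1. Qed.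

Theorem theorem4p4 (R : realType) (n : nat) (hn : (0 < n)%N) (b : 'I_n -> nat)
    (hb : forall i : 'I_n, (0 < b i)%N)
    (hne : ~ (n = 1%N /\ b (Ordinal hn) = 1%N)) :
  ((1 < b (Ordinal hn))%N ->
     is_combinatorial_diameter (parking_polytope R b)
       (minn (2 * n) ((n * (n - 1)) %/ 2 + 1))) /\
  (b (Ordinal hn) = 1%N ->
     is_combinatorial_diameter (parking_polytope R b)
       (minn (2 * (n - 1)) ((n * (n - 1)) %/ 2))).
Proof.
have -> : ((n * (n - 1)) %/ 2 = 'C(n, 2))%N by rewrite bin2 divn2 subn1.
have bin := double_bin2 n.
(* This is (n - 2)(n - 3) >= 0. It makes the sorting route short enough whenever the route through
   the empty ranking is too long. *)
have binge : (4 * n <= n * n.-1 + 6)%N.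
  by case: (n) => [//|[//|[//|[//|m]]]] /=; nia.
split=> hb1.
  have z0 : nat_of_bool (b (Ordinal hn) == 1%N) = 0%N.
    by case: eqP => // b1; rewrite b1 in hb1.
  (* For n <= 4 the minimum is C(n,2) + 1, and the extra step comes from leaving one coordinate of
     the reversal unranked, which forces [1 <= c]. For larger n the minimum is 2n and two full
     rankings suffice. *)
  pose l0 := if (n <= 4)%N then n.-1 else n.
  have l0n : (l0 <= n)%N by rewrite /l0; case: ifP; lia.
  apply: (@polytope_diameter R n b hb hn hne _ n l0); rewrite ?z0 ?addn0 //.
  - move=> p q k l; rewrite !addn0 => kn ln.
    have [|kl] := leqP (k + l) (minn (2 * n) ('C(n, 2) + 1)); first by left.
    right; exists n; rewrite addn0 kn ln; split => //.
    by move: kl; lia.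
  - by rewrite /l0; case: ifP; lia.
  - by rewrite ltnn.
  move=> m [[]//|[c []]]; rewrite subnn add0n addn0 /l0 -mulnn.
  have [n4|n5] := leqP n 4.
    have -> : (n - n.-1 = 1)%N by lia.
    move=> c1 cn mc; have : (c * c + 4 <= 5 * c)%N by nia.
    by move: mc bin; lia.
  rewrite subnn addn0 => _ cn mc.
  have [c5|c5] := leqP c 5.
    have : (c * c <= 5 * c)%N by nia.
    have : (5 * n <= n * n.-1 + n)%N by nia.
    by move: mc; lia.
  (* Concavity in [c]: this is (n - c)(n + c - 5) >= 0. *)
  have : (c * c + 5 * n <= n * n + 5 * c)%N by nia.
  have : (n * n = n * n.-1 + n)%N by nia.
  by move: mc; lia.
have z1 : nat_of_bool (b (Ordinal hn) == 1%N) = 1%N by rewrite hb1.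
have n1 : (1 < n)%N.
  by rewrite ltn_neqAle hn andbT eq_sym; apply/eqP => n1; apply: hne.
apply: (@polytope_diameter R n b hb hn hne _ n.-1 n.-1); rewrite ?z1 ?addn1 ?prednK //.
- move=> p q k l kn ln.
  have [|kl] := leqP (k + l) (minn (2 * (n - 1)) 'C(n, 2)); first by left.
  right; exists n.-1; rewrite addn1 prednK //; split => //.
  + by move: kn; lia.
  + by move: ln; lia.
  + by move: kl kn ln; lia.
move=> m [[_ mC]|[c []]]; first by move: mC; lia.
have -> : (n - n.-1 = 1)%N by lia.
rewrite -mulnn => c2 cn mc.
(* For 2 <= c <= 4, (c - 1)(4 - c) >= 0 gives C(n,2); beyond that the value at c = n gives 2(n -
   1). *)
have [c4|c4] := leqP c 4.
  have : (c * c + 4 <= 5 * c)%N by nia.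
  by move: mc bin; lia.
have : (c * c + 5 * n <= n * n + 5 * c)%N by nia.
have : (n * n = n * n.-1 + n)%N by nia.
by move: mc; lia.
Qed.
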